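(* Let $\mathcal{T}$ be the family of Poncelet triangles inscribed in the non-circular ellipse $\mathcal{E}$ and circumscribing the nested ellipse $\mathcal{E}_c$, and let $\mathcal{R}$ be the region swept by the circumcircle over $\mathcal{T}$. Then the boundary $\partial\mathcal{R}$ is the union of two closed curves given implicitly by a polynomial of degree $4$. One of these curves is externally tangent to $\mathcal{E}$ at two points, and the other is internally tangent to $\mathcal{E}$ at two points.
   Context: $\mathcal{E}$ is the ellipse $x^2/a^2+y^2/b^2=1$ with $a>b>0$. $\mathcal{E}_c$ is an ellipse contained in the interior of $\mathcal{E}$ such that some triangle is inscribed in $\mathcal{E}$ and has its three sides tangent to $\mathcal{E}_c$; by Poncelet's porism every point of $\mathcal{E}$ is then a vertex of such a triangle, and $\mathcal{T}$ is the one-parameter family of all such triangles. $\mathcal{R}$ is the union of the circumcircles of the triangles in $\mathcal{T}$; its boundary $\partial\mathcal{R}$ is the envelope of these circumcircles. *)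

(* Defs.v *)
From HB Require Import structures.
From mathcomp Require Import all_boot all_order all_algebra.
From mathcomp Require Import all_classical all_reals all_analysis.
(* The notations of mpoly clash with those of the analysis library. *)
From mathcomp Require Import -(notations) mpoly.
Set Implicit Arguments.
Unset Strict Implicit.
Unset Printing Implicit Defensive.
Import Order.TTheory GRing.Theory Num.Theory.
Import numFieldNormedType.Exports.
Local Open Scope classical_set_scope.
Local Open Scope ring_scope.

Section PlaneGeometry.
Variable R : realType.
Implicit Types (G H A : set (R * R)) (p q u v w o : R * R).

Definition ellipse_form (a b : R) p : R :=
  p.1 ^+ 2 / a ^+ 2 + p.2 ^+ 2 / b ^+ 2.

Definition ellipse (a b : R) : set (R * R) :=
  [set p | ellipse_form a b p = 1].

Definition ellipse_inside (a b : R) : set (R * R) :=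
  [set p | ellipse_form a b p < 1].

Definition ellipse_outside (a b : R) : set (R * R) :=
  [set p | 1 < ellipse_form a b p].

(* Coordinates of p in the frame centred at o and rotated by the angle th. *)
Definition frame_coord o (th : R) p : R * R :=
  ((p.1 - o.1) * cos th + (p.2 - o.2) * sin th,
   (p.2 - o.2) * cos th - (p.1 - o.1) * sin th).

(* An ellipse in arbitrary position: centre o, semi-axes al and be, the first
   one making the angle th with the x-axis. *)
Definition placed_ellipse o (th al be : R) : set (R * R) :=
  frame_coord o th @^-1` ellipse al be.

(* v is the velocity at p of a path drawn in G.  The path is defined on both
   sides of time 0, so there is no nonzero velocity at an endpoint of a
   segment, at a cusp or at a corner. *)
Definition velocity_at G p v : Prop :=
  exists g : R -> R * R,
    [/\ g 0 = p, \forall t \near (0 : R), G (g t)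
      & is_derive (0 : R) (1 : R) g v].

Definition tangent_at G H p : Prop :=
  exists v, [/\ v <> 0, velocity_at G p v & velocity_at H p v].

Definition segment p q : set (R * R) :=
  [set p + t *: (q - p) | t in `[0, 1]%classic].

Definition noncollinear u v w : Prop :=
  (v.1 - u.1) * (w.2 - u.2) - (v.2 - u.2) * (w.1 - u.1) <> 0.

Record triangle := Triangle {
  vertexA : R * R;
  vertexB : R * R;
  vertexC : R * R;
  triangle_noncollinear : noncollinear vertexA vertexB vertexC }.

Definition inscribed (t : triangle) G : Prop :=
  [/\ G (vertexA t), G (vertexB t) & G (vertexC t)].

Definition circumscribes (t : triangle) G : Prop :=
  [/\ exists p, tangent_at (segment (vertexA t) (vertexB t)) G p,
      exists p, tangent_at (segment (vertexB t) (vertexC t)) G p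
    & exists p, tangent_at (segment (vertexC t) (vertexA t)) G p].

Definition poncelet_family G H : set triangle :=
  [set t | inscribed t G /\ circumscribes t H].

Definition circle o (r : R) : set (R * R) :=
  [set p | (p.1 - o.1) ^+ 2 + (p.2 - o.2) ^+ 2 = r ^+ 2].

(* The vertices are not collinear, so exactly one circle (o, |r|) contributes
   to this set. *)
Definition circumcircle (t : triangle) : set (R * R) :=
  [set p | exists o r, inscribed t (circle o r) /\ circle o r p].

Definition swept_region (T : set triangle) : set (R * R) :=
  \bigcup_(t in T) circumcircle t.

Definition boundary A : set (R * R) := closure A `\` interior A.

Definition simple_closed_curve G : Prop :=
  exists g : R -> R * R,
    [/\ {within `[0, 1]%classic, continuous g}, g 0 = g 1,
        set_inj `[0, 1[%classic g & G = g @` `[0, 1]%classic].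

Definition zero_locus (Q : mpoly 2 R) : set (R * R) :=
  [set p | meval (fun i => if i == ord0 then p.1 else p.2) Q = 0].

(* Here msize is 1 + the total degree, and 0 for the zero polynomial. *)
Definition has_degree (Q : mpoly 2 R) (d : nat) : Prop :=
  msize Q = d.+1.

Definition tangent_at_two_points G H : Prop :=
  exists p q, [/\ p <> q, G `&` H = [set p; q],
                  tangent_at G H p & tangent_at G H q].

(* "Externally" and "internally" refer to the side of the ellipse on which the
   curve lies; a curve that encloses the ellipse is on the external side. *)
Definition externally_tangent_at_two_points G (a b : R) : Prop :=
  tangent_at_two_points G (ellipse a b) /\
  G `<=` ellipse a b `|` ellipse_outside a b.

Definition internally_tangent_at_two_points G (a b : R) : Prop :=
  tangent_at_two_points G (ellipse a b) /\
  G `<=` ellipse a b `|` ellipse_inside a b.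

End PlaneGeometry.

(* Main.v *)
Require Import Defs.
From HB Require Import structures.
From mathcomp Require Import all_boot all_order all_algebra.
From mathcomp Require Import all_classical all_reals all_analysis.
From mathcomp Require Import -(notations) mpoly.
From mathcomp Require Import complex.
From mathcomp Require Import zify ring lra.
Import Order.TTheory GRing.Theory Num.Theory.
Import numFieldNormedType.Exports.
Local Open Scope classical_set_scope.
Local Open Scope ring_scope.
Set Implicit Arguments.
Unset Strict Implicit.
Unset Printing Implicit Defensive.

(** In the coordinate z = x/a + i y/b the outer ellipse is the unit circle, and
    the inner one is an ellipse with foci f and g in the open unit disc.  Put
    s = f + g, p = f g and w(z) = z^2 - s z + p = (z - f)(z - g); a prime
    denotes complex conjugation.

    A chord from z to z1 of the unit circle touches the inner ellipse iff a
    symmetric polynomial [tangent_chord] in z, z1 vanishes.  As a quadratic in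
    z1 its constant coefficient is w(z) and its leading one is z^2 w(z)', so
    the two tangents from z lead to points with product w(z) / (z^2 w(z)').
    Therefore the vertices of a Poncelet triangle, with product l, all satisfy
    z w(z) = l z^2 w(z)': they are a fibre of a Blaschke product of degree 3.
    By Vieta, one such triangle determines the constant of the polynomial
    [tangent_chord] in terms of s and p ([family_fibre]); with that constant,
    every fibre over a unit l is a Poncelet triangle ([fibre_family]), because
    the argument of the Blaschke product grows by 6 pi around the circle and
    hence the fibre has three points ([blaschke_angles]).

    The circumcircle of the triangle over l has the equation A + Re(l W) = 0,
    where A is a real quadratic function and W = s' - p' z - z' is real affine
    ([vertex_circle]): on the unit circle A = Re w and W = - z w', so the
    equation holds at the vertices.  Letting l run over the unit circle, the
    swept region is A^2 <= |W|^2, bounded by the quartic A^2 = |W|^2.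

    W has a unique zero z0, which lies in the disc, and A < 0 there.  On a ray
    from z0, |W| is linear and A is quadratic with positive leading
    coefficient.  So each of A = |W| and A = - |W| meets the ray exactly once:
    both curves are star-shaped about z0, hence simple and closed, and so is
    the outer ellipse.  On that ellipse |A| = |Re w| <= |w| = |W|, whence each
    ray meets A = - |W|, then the ellipse, then A = |W|.  Where two of these
    ordered radial functions agree their derivatives agree too, and the curves
    are tangent ([star_curve_tangent]).  The contacts are the points of the
    unit circle where w is a positive, respectively negative, real; as the
    argument of w grows by 4 pi, there are two of each ([contact_angles]). *)

(** * Tangent chords of the unit circle and cubic fibres *)

(** Residuals of equations make polynomial identities provable modulo
    hypotheses: [combine c] proves x = y when x - y is the combination c of
    residuals of known equations. *)
Definition residual (V : zmodType) (x y : V) of x = y := x - y.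

Lemma residual0 (V : zmodType) (x y : V) (e : x = y) : residual e = 0.
Proof. by rewrite /residual e subrr. Qed.

Lemma eq_by_residual (V : zmodType) (c x y : V) : c = 0 -> x - y = c -> x = y.
Proof. by move=> -> /eqP; rewrite subr_eq0 => /eqP. Qed.

Ltac combine c :=
  apply: (eq_by_residual (c := c));
  [by rewrite !residual0; ring | by rewrite /residual; ring].

Section Closure.
Variable F : fieldType.
Implicit Types (s p k z w : F).

(** Here s', p' stand for the conjugates of s, p.  For z, w on the unit circle
    this polynomial vanishes iff the chord from z to w touches the conic with
    foci of sum s and product p whose size is encoded by k; see
    [line_tangentE]. *)
Definition tangent_chord s p s' p' k z w : F :=
  (z + w) ^+ 2 - (z + w) * (s + z * w * s') + p + (z * w) ^+ 2 * p'
  - k * (z * w).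

Lemma tangent_chordC s p s' p' k z w :
  tangent_chord s p s' p' k z w = tangent_chord s p s' p' k w z.
Proof. by rewrite /tangent_chord; ring. Qed.

(** The polynomial is quadratic in its last argument, with roots w1, w2: the
    identity compares the product of the roots with the extreme
    coefficients. *)
Lemma tangent_chord_pair s p s' p' k z w1 w2 : w1 != w2 ->
  tangent_chord s p s' p' k z w1 = 0 -> tangent_chord s p s' p' k z w2 = 0 ->
  z ^+ 2 - s * z + p = w1 * w2 * (1 - s' * z + p' * z ^+ 2).
Proof.
rewrite -subr_eq0 => w12 h1 h2; apply: (mulfI w12); apply/eqP.
rewrite -subr_eq0; apply/eqP.
transitivity (w1 * tangent_chord s p s' p' k z w2
              - w2 * tangent_chord s p s' p' k z w1); last first.
  by rewrite h1 h2 !mulr0 subr0.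
by rewrite /tangent_chord; ring.
Qed.

(** Divided differences of the cubic on its three roots yield e1, then e2, then
    e3. *)
Lemma cubic_vieta (e1 e2 e3 z1 z2 z3 : F) :
  z1 != z2 -> z2 != z3 -> z1 != z3 ->
  z1 ^+ 3 - e1 * z1 ^+ 2 + e2 * z1 - e3 = 0 ->
  z2 ^+ 3 - e1 * z2 ^+ 2 + e2 * z2 - e3 = 0 ->
  z3 ^+ 3 - e1 * z3 ^+ 2 + e2 * z3 - e3 = 0 ->
  [/\ e1 = z1 + z2 + z3, e2 = z1 * z2 + z2 * z3 + z1 * z3
    & e3 = z1 * z2 * z3].
Proof.
rewrite -!(subr_eq0 z1) -(subr_eq0 z2) => z12 z23 z13 h1 h2 h3.
have E : e1 = z1 + z2 + z3.
  apply: (mulfI z12); apply: (mulfI z23); apply: (mulfI z13).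
  combine ((z1 - z2) * (residual h2 - residual h3)
           - (z2 - z3) * (residual h1 - residual h2)).
have E2 : e2 = z1 * z2 + z2 * z3 + z1 * z3.
  apply: (mulfI z12).
  combine (residual h1 - residual h2 + (z1 - z2) * (z1 + z2) * residual E).
split=> //.
combine (z1 * residual E2 - residual h1 - z1 ^+ 2 * residual E).
Qed.

Definition vieta_triple (s p s' p' z1 z2 z3 : F) :=
  s = z1 + z2 + z3 - z1 * z2 * z3 * p' /\
  p = z1 * z2 + z2 * z3 + z1 * z3 - z1 * z2 * z3 * s'.

(** The three equations say that z1, z2, z3 are the roots of the cubic
    X^3 - (s + l p') X^2 + (p + l s') X - l, so l is their product. *)
Lemma blaschke_vieta s p s' p' l z1 z2 z3 :
  z1 != z2 -> z2 != z3 -> z1 != z3 ->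
  z1 * (z1 ^+ 2 - s * z1 + p) = l * (1 - s' * z1 + p' * z1 ^+ 2) ->
  z2 * (z2 ^+ 2 - s * z2 + p) = l * (1 - s' * z2 + p' * z2 ^+ 2) ->
  z3 * (z3 ^+ 2 - s * z3 + p) = l * (1 - s' * z3 + p' * z3 ^+ 2) ->
  vieta_triple s p s' p' z1 z2 z3.
Proof.
move=> z12 z23 z13 h1 h2 h3.
have [||| E1 E2 E3] := @cubic_vieta (s + l * p') (p + l * s') l z1 z2 z3 z12
  z23 z13.
- combine (residual h1).
- combine (residual h2).
- combine (residual h3).
by split; rewrite -E3 -?E1 -?E2; ring.
Qed.

(** This is the closing condition of the porism: as soon as a triple is a
    fibre, each of its sides touches the conic iff k = 1 + p p' - s s', a
    condition that does not involve the triple. *)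
Lemma tangent_chord_vieta s p s' p' k z1 z2 z3 :
  vieta_triple s p s' p' z1 z2 z3 ->
  tangent_chord s p s' p' k z1 z2 = z1 * z2 * (1 + p * p' - s * s' - k).
Proof. by case=> -> ->; rewrite /tangent_chord; ring. Qed.

End Closure.

(** * Foci and the dual conic *)

Section DualConic.
Local Open Scope complex_scope.
Variable R : realType.
Variables O1 O2 U1 U2 V1 V2 : R.
Let m11 := U1 ^+ 2 + V1 ^+ 2.
Let m12 := U1 * U2 + V1 * V2.
Let m22 := U2 ^+ 2 + V2 ^+ 2.

(** The conic is the image of the unit circle under
    (c, s) |-> O + c U + s V.  The matrix m = U U^T + V V^T describes its
    tangent lines, and its foci are O + d and O - d, where the complex number d
    has the square (m11 - m22) + 2 i m12. *)
Definition focal_sum : R[i] := (2 * O1) +i* (2 * O2).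
Definition focal_prod : R[i] :=
  (O1 ^+ 2 - O2 ^+ 2 - (m11 - m22)) +i* (2 * O1 * O2 - 2 * m12).
Definition focal_const : R := 2 * (m11 + m22) - 2 * (O1 ^+ 2 + O2 ^+ 2).

(** Tangency to the conic of the line n1 x + n2 y = c, which is a quadratic
    condition on the coefficients of the line. *)
Definition line_tangent (n1 n2 c : R) :=
  (c - (n1 * O1 + n2 * O2)) ^+ 2 =
  (n1 * U1 + n2 * U2) ^+ 2 + (n1 * V1 + n2 * V2) ^+ 2.

(** Up to the nonzero factors d = |z - w|^2 and 4 z w, the complex polynomial is
    the real condition [line_tangent] on the line through z and w; the identity
    [key] holds modulo the equations of the unit circle. *)
Lemma line_tangentE x1 y1 x2 y2 :
  x1 ^+ 2 + y1 ^+ 2 = 1 -> x2 ^+ 2 + y2 ^+ 2 = 1 -> (x1, y1) != (x2, y2) ->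
  line_tangent (y2 - y1) (x1 - x2) (x1 * y2 - x2 * y1) <->
  tangent_chord focal_sum focal_prod (conjc focal_sum) (conjc focal_prod)
    focal_const%:C
    (x1 +i* y1) (x2 +i* y2) = 0.
Proof.
move=> h1 h2 ne.
have q1 : y1 ^+ 2 = 1 - x1 ^+ 2 by rewrite -h1; ring.
have q2 : y2 ^+ 2 = 1 - x2 ^+ 2 by rewrite -h2; ring.
pose E := (x1 * y2 - x2 * y1 - ((y2 - y1) * O1 + (x1 - x2) * O2)) ^+ 2 -
  (((y2 - y1) * U1 + (x1 - x2) * U2) ^+ 2 +
   ((y2 - y1) * V1 + (x1 - x2) * V2) ^+ 2).
set T := tangent_chord _ _ _ _ _ _ _.
pose d := (x1 - x2) ^+ 2 + (y1 - y2) ^+ 2.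
have key : d%:C * T = (4 * E)%:C * ((x1 +i* y1) * (x2 +i* y2)).
  apply/eqP; rewrite eq_complex; apply/andP; split; apply/eqP.
    rewrite /T /d /E /tangent_chord /focal_sum /focal_prod /focal_const /m11
      /m12 /m22.
    rewrite !expr2 /=.
    ring: q1 q2.
  rewrite /T /d /E /tangent_chord /focal_sum /focal_prod /focal_const /m11 /m12
    /m22.
  rewrite !expr2 /=.
  ring: q1 q2.
have d0 : d%:C != 0.
  rewrite eq_complex /= eqxx andbT; apply: contra ne => d0.
  have /andP[] : (x1 - x2 == 0) && (y1 - y2 == 0).
    by rewrite -!(sqrf_eq0 (_ - _)) -paddr_eq0 ?sqr_ge0.
  by rewrite !subr_eq0 => /eqP-> /eqP->.
have unit_neq0 (x y : R) : x ^+ 2 + y ^+ 2 = 1 -> x +i* y != 0.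
  move=> h; apply/negP => /eqP[x0 y0].
  by move: h; rewrite x0 y0 !expr0n addr0 => /esym/eqP; rewrite oner_eq0.
have -> : line_tangent (y2 - y1) (x1 - x2) (x1 * y2 - x2 * y1) <-> E = 0.
  by rewrite /line_tangent /E; split=> [->|/eqP];
    rewrite ?subrr ?subr_eq0// => /eqP.
split=> [E0|T0].
  by move: key; rewrite E0 mulr0 mul0r => /eqP;
    rewrite mulf_eq0 (negPf d0) => /eqP.
move: key; rewrite T0 mulr0 => /esym/eqP.
rewrite !mulf_eq0 (negPf (unit_neq0 _ _ h1)) (negPf (unit_neq0 _ _ h2)) !orbF.
by rewrite eq_complex /= eqxx andbT mulf_eq0 pnatr_eq0 => /eqP.
Qed.

Definition normsq (z : R[i]) := complex.Re z ^+ 2 + complex.Im z ^+ 2.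

(** The support function of the conic dominates that of the segment between its
    foci, because m - d d^T is a nonnegative multiple of the identity.  In the
    direction of the focus f, a point P of the conic thus satisfies
    |f|^2 <= f . P, so |f| <= |P| < 1. *)
Lemma focus_in_disc (d1 d2 : R) :
  d1 ^+ 2 - d2 ^+ 2 = m11 - m22 -> d1 * d2 = m12 -> U1 * V2 - U2 * V1 != 0 ->
  (forall c s, c ^+ 2 + s ^+ 2 = 1 ->
     (O1 + U1 * c + V1 * s) ^+ 2 + (O2 + U2 * c + V2 * s) ^+ 2 < 1) ->
  (O1 + d1) ^+ 2 + (O2 + d2) ^+ 2 < 1.
Proof.
move=> hd hm D in_disc.
have dle : d1 ^+ 2 + d2 ^+ 2 <= m11 + m22.
  rewrite -ler_sqr ?nnegrE ?addr_ge0 ?sqr_ge0//.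
  have -> : (d1 ^+ 2 + d2 ^+ 2) ^+ 2
          = (d1 ^+ 2 - d2 ^+ 2) ^+ 2 + 4 * (d1 * d2) ^+ 2 by ring.
  rewrite hd hm -subr_ge0.
  have -> : (m11 + m22) ^+ 2 - ((m11 - m22) ^+ 2 + 4 * m12 ^+ 2)
          = 4 * (U1 * V2 - U2 * V1) ^+ 2 by rewrite /m11 /m12 /m22; ring.
  by rewrite mulr_ge0 ?sqr_ge0.
set f1 := O1 + d1; set f2 := O2 + d2.
case: (ltP (f1 ^+ 2 + f2 ^+ 2) 1) => // big.
pose u := f1 * U1 + f2 * U2; pose v := f1 * V1 + f2 * V2.
pose q := Num.sqrt (u ^+ 2 + v ^+ 2).
have q2 : q ^+ 2 = u ^+ 2 + v ^+ 2 by rewrite sqr_sqrtr ?addr_ge0 ?sqr_ge0.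
have support : f1 * d1 + f2 * d2 <= q.
  have [n0|n0] := leP (f1 * d1 + f2 * d2) 0;
    first exact: le_trans (sqrtr_ge0 _).
  rewrite -ler_sqr ?nnegrE ?sqrtr_ge0 ?(ltW n0)// q2 -subr_ge0.
  have E11 : m11 - d1 ^+ 2 = (m11 + m22 - (d1 ^+ 2 + d2 ^+ 2)) / 2.
    by lra.
  have E22 : m22 - d2 ^+ 2 = (m11 + m22 - (d1 ^+ 2 + d2 ^+ 2)) / 2.
    by lra.
  have -> : u ^+ 2 + v ^+ 2 - (f1 * d1 + f2 * d2) ^+ 2
    = (m11 - d1 ^+ 2) * f1 ^+ 2 + (m22 - d2 ^+ 2) * f2 ^+ 2
      + 2 * f1 * f2 * (m12 - d1 * d2).
    by rewrite /u /v /m11 /m12 /m22; ring.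
  rewrite hm subrr mulr0 addr0 E11 E22.
  by rewrite addr_ge0// mulr_ge0 ?sqr_ge0// divr_ge0 ?subr_ge0.
have q0 : 0 < q.
  rewrite sqrtr_gt0 lt_neqAle addr_ge0 ?sqr_ge0// andbT eq_sym.
  rewrite paddr_eq0 ?sqr_ge0// !sqrf_eq0; apply/negP => /andP[/eqP + /eqP +].
  rewrite /u /v => u0 v0.
  have f10 : f1 = 0.
    apply: (mulfI D); rewrite mulr0;
      combine (V2 * residual u0 - U2 * residual v0).
  have f20 : f2 = 0.
    apply: (mulfI D); rewrite mulr0;
      combine (U1 * residual v0 - V1 * residual u0).
  by move: big; rewrite f10 f20 expr0n addr0 ler10.
have /in_disc : (u / q) ^+ 2 + (v / q) ^+ 2 = 1.
  by rewrite !expr_div_n -mulrDl -q2 divff ?expf_neq0 ?gt_eqF.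
set P1 := O1 + _ + _; set P2 := O2 + _ + _ => P_lt1.
have Pf : f1 ^+ 2 + f2 ^+ 2 <= f1 * P1 + f2 * P2.
  have -> : f1 * P1 + f2 * P2 = f1 * O1 + f2 * O2 + q.
    have -> : q = (u ^+ 2 + v ^+ 2) / q by rewrite -q2 expr2 mulfK ?gt_eqF.
    by rewrite /P1 /P2 /u /v; ring.
  by move: support; rewrite /f1 /f2; lra.
have : 0 <= (f1 - P1) ^+ 2 + (f2 - P2) ^+ 2 by rewrite addr_ge0 ?sqr_ge0.
have -> : (f1 - P1) ^+ 2 + (f2 - P2) ^+ 2 = f1 ^+ 2 + f2 ^+ 2
  + (P1 ^+ 2 + P2 ^+ 2) - 2 * (f1 * P1 + f2 * P2) by ring.
by move: Pf P_lt1 big; lra.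
Qed.

Lemma foci_exist : U1 * V2 - U2 * V1 != 0 ->
  (forall c s, c ^+ 2 + s ^+ 2 = 1 ->
     (O1 + U1 * c + V1 * s) ^+ 2 + (O2 + U2 * c + V2 * s) ^+ 2 < 1) ->
  exists f g : R[i], [/\ f + g = focal_sum, f * g = focal_prod,
    normsq f < 1 & normsq g < 1].
Proof.
move=> D in_disc.
have := sqr_sqrtc ((m11 - m22) +i* (2 * m12)).
case: (sqrtc _) => d1 d2 /eqP; rewrite expr2 eq_complex /=.
move=> /andP[/eqP h1 /eqP h2].
have h3 : d1 * d2 = m12 by lra.
exists ((O1 + d1) +i* (O2 + d2)), ((O1 - d1) +i* (O2 - d2)); split.
- by apply/eqP; rewrite eq_complex /=; apply/andP; split; apply/eqP; ring.
- by apply/eqP; rewrite eq_complex /=; apply/andP; split; apply/eqP; lra.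
- by apply: focus_in_disc => //; rewrite -h1; ring.
- apply: (@focus_in_disc (- d1) (- d2)) => //; first by rewrite -h1; ring.
  by rewrite mulrNN.
Qed.
End DualConic.

(** * Angles and lifts of the argument *)

Section Angles.
Local Open Scope complex_scope.
Variable R : realType.
Implicit Types (t x y : R).

Lemma pi2_gt0 : 0 < pi *+ 2 :> R.
Proof. by rewrite mulrn_wgt0 ?pi_gt0. Qed.

Lemma periodicz (f : R -> R) (T : R) (k : int) x :
  periodic f T -> f (x + T *~ k) = f x.
Proof.
move=> fT; case: k => n; first exact: periodicn.
by rewrite NegzE mulrNz -{2}(subrK (T *+ n.+1) x) (periodicn fT).
Qed.

Lemma cos_eq1_small x : 0 <= x < pi *+ 2 -> cos x = 1 -> x = 0.
Proof.
move=> /andP[x0 x2]; apply: contra_eq => xn0.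
have sx : 0 < sin (x / 2).
  apply: sin_gt0_pi; apply/andP; split.
    by rewrite divr_gt0// lt_neqAle eq_sym xn0 x0.
  by rewrite ltr_pdivrMr ?mulr_natr.
rewrite (splitr x) -mulr2n cos_mulr2n cos2sin2; move: sx.
by move=> /(exprn_gt0 2) s; apply/eqP; lra.
Qed.

Lemma cos_eq1P x : cos x = 1 <-> exists k : int, x = (pi *+ 2) *~ k.
Proof.
split=> [c1|[k ->]]; last by rewrite -[_ *~ _]add0r periodicz ?cos0//;
  exact: cosD2pi.
pose k := Num.floor (x / (pi *+ 2)); exists k.
apply/eqP; rewrite -subr_eq0; apply/eqP; apply: cos_eq1_small; last first.
  by rewrite -mulrNz periodicz//; exact: cosD2pi.
have /andP[] := floor_itv (x / (pi *+ 2)).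
rewrite -/k ler_pdivlMr ?pi2_gt0// ltr_pdivrMr ?pi2_gt0// => k1.
by rewrite intrD mulrDl mul1r mulrzl => h;
  rewrite subr_ge0 ltrBlDl -mulrzl k1 mulrzl h.
Qed.

Lemma angle_inj x y : 0 <= x < pi *+ 2 -> 0 <= y < pi *+ 2 ->
  cos x = cos y -> sin x = sin y -> x = y.
Proof.
wlog : x y / y <= x.
  by move=> h hx hy *; case: (leP y x) => [|/ltW] yx; [|symmetry]; exact: h.
move=> yx /andP[x0 x2] /andP[y0 y2] cxy sxy.
apply/eqP; rewrite -subr_eq0; apply/eqP; apply: cos_eq1_small.
  by rewrite subr_ge0 yx /= (le_lt_trans _ x2)// gerBl.
by rewrite cosB cxy sxy -!expr2 cos2Dsin2.
Qed.

Lemma angle_exists (c s : R) : c ^+ 2 + s ^+ 2 = 1 ->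
  exists t, [/\ 0 <= t < pi *+ 2, c = cos t & s = sin t].
Proof.
move=> cs.
have c1 : -1 <= c <= 1.
  by rewrite -ler_norml -(@expr_le1 _ 2)// real_normK ?num_real// -cs lerDl
    sqr_ge0.
have ss : Num.sqrt (1 - c ^+ 2) = `|s| by rewrite -cs addrC addKr sqrtr_sqr.
have [s0|s0] := leP 0 s.
  exists (acos c); rewrite acosK ?sin_acos ?ss ?ger0_norm ?acos_ge0//=;
    split=> //.
  by rewrite (le_lt_trans (acos_lepi c1))// mulr2n ltrDl pi_gt0.
have c1' : -1 <= c < 1.
  move/andP: c1 => [-> /=]; rewrite le_eqVlt => /orP[/eqP c1|//].
  have : s ^+ 2 = 0 by move: cs; rewrite c1 expr1n; lra.
  by move/eqP; rewrite sqrf_eq0 lt_eqF.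
exists (- acos c + pi *+ 2); rewrite cosD2pi sinD2pi cosN sinN acosK
  ?sin_acos//.
rewrite ss ltr0_norm// opprK addrC subr_ge0 ltrBlDr ltrDl acos_gt0//.
by rewrite (le_trans (acos_lepi c1))// mulr2n lerDl pi_ge0.
Qed.

(** A strictly increasing phase that makes n turns on a period passes each
    direction c exactly n times: the levels c + 2 pi k between P 0 and
    P (2 pi) are n in number, and each is attained once. *)
Lemma turns_crossing (P : R -> R) (n : nat) (c : R) :
  continuous P -> {homo P : x y / x < y} ->
  P (pi *+ 2) = P 0 + (pi *+ 2) *+ n ->
  exists t : 'I_n -> R, [/\ injective t, forall i, 0 <= t i < pi *+ 2 &
    forall x, 0 <= x < pi *+ 2 -> cos (P x - c) = 1 <-> exists i, x = t i].
Proof.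
move=> cP incP turnP; have T0 := pi2_gt0; set T : R := pi *+ 2 in T0 turnP *.
have lemonoP : {mono P : x y / x <= y} := le_mono incP.
have monoP := leW_mono lemonoP.
pose k0 := Num.ceil ((P 0 - c) / T).
have /andP[] := ceil_itv ((P 0 - c) / T).
rewrite -/k0 ltr_pdivlMr// ler_pdivrMr// !mulrzl => k0lt k0ge.
rewrite ltrBrDl in k0lt; rewrite lerBlDl in k0ge.
have /choice[t ht] : forall i : 'I_n, exists x, (0 <= x < T) /\ P x
  = c + T *~ (k0 + i).
  move=> i.
  have lo : P 0 <= c + T *~ (k0 + i).
    rewrite mulrzDr addrA (le_trans k0ge)// lerDl.
    by rewrite -pmulrn mulrn_wge0 ?ltW.
  have hi : c + T *~ (k0 + i) < P T.
    rewrite turnP (_ : k0 + i = k0 - 1 + i.+1); last by rewrite intS; ring.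
    rewrite mulrzDr addrA ltr_leD// -pmulrn ler_wpMn2l ?ltW//.
  have [||x] := @IVT _ P 0 T (c + T *~ (k0 + i)) (ltW T0).
  - exact: continuous_subspaceT.
  - by rewrite ge_min lo /= le_max (ltW hi) orbT.
  rewrite in_itv /= => /andP[x0 xT] Px; exists x; split=> //.
  by rewrite x0 -monoP Px.
exists t; split.
- move=> i j tij; apply/val_inj; move: (ht i).2; rewrite tij (ht j).2.
  by move=> /addrI/(mulrIz (lt0r_neq0 T0))/addrI[].
- by move=> i; case: (ht i).
move=> x /andP[x0 xT]; split=> [/cos_eq1P[k Pk]|[i ->]]; last first.
  by apply/cos_eq1P; exists (k0 + i); rewrite (ht i).2 addrC addKr.
have {}Pk : P x = c + T *~ k by rewrite -Pk addrC subrK.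
have lo : k0 - 1 < k.
  rewrite -(ltr_pMz2l T0) -(ltrD2l c) -Pk (lt_le_trans k0lt)//.
  by rewrite lemonoP.
have hi : k < k0 + n.
  rewrite -(ltr_pMz2l T0) -(ltrD2l c) -Pk mulrzDr addrA.
  by rewrite (lt_le_trans (incP _ _ xT))// turnP -pmulrn lerD2r.
have kn : (`|k - k0| < n)%N by lia.
exists (Ordinal kn); apply: (inc_inj lemonoP).
by rewrite (ht (Ordinal kn)).2 Pk /=; congr (_ + _ *~ _); lia.
Qed.

Definition cis t : R[i] := cos t +i* sin t.

Lemma cisD x y : cis (x + y) = cis x * cis y.
Proof.
rewrite /cis cosD sinD; apply/eqP; rewrite eq_complex /= eqxx.
by rewrite [sin x * _ + _]addrC eqxx.
Qed.

Lemma cisN x : cis (- x) = (conjc (cis x)).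
Proof. by rewrite /cis cosN sinN. Qed.

Lemma cis_eq1P x : cis x = 1 <-> cos x = 1.
Proof.
split=> [[]//|c1]; apply/eqP; rewrite eq_complex /= c1 eqxx /= cos1sin0 ?c1
  ?normr1//.
Qed.

(** A continuous argument of cis t - f.  Factoring out cis t leaves
    1 - f / cis t, which for |f| < 1 stays in the right half-plane, where the
    argument is an arctangent. *)
Definition arg_lift (f : R[i]) t : R :=
  t + atan ((complex.Re f * sin t - complex.Im f * cos t)
            / (1 - (complex.Re f * cos t + complex.Im f * sin t))).

Section ArgLift.
Variable f : R[i].
Hypothesis f_lt1 : normsq f < 1.
Let f1 := complex.Re f.
Let f2 := complex.Im f.
Let D t := 1 - (f1 * cos t + f2 * sin t).
Let N t := f1 * sin t - f2 * cos t.

Let sumsq t : (1 - D t) ^+ 2 + N t ^+ 2 = normsq f.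
Proof.
transitivity (normsq f * (cos t ^+ 2 + sin t ^+ 2)).
  by rewrite /D /N /normsq -/f1 -/f2; ring.
by rewrite cos2Dsin2 mulr1.
Qed.

Let D_gt0 t : 0 < D t.
Proof.
have : (1 - D t) ^+ 2 < 1.
  by rewrite (le_lt_trans _ f_lt1)// -(sumsq t) lerDl sqr_ge0.
rewrite -real_normK ?num_real// expr_lt1// ltr_norml => /andP[_].
by rewrite ltrBlDl; lra.
Qed.

Lemma arg_lift_turn : arg_lift f (pi *+ 2) = arg_lift f 0 + pi *+ 2.
Proof.
by rewrite /arg_lift -[pi *+ 2 in LHS]add0r cosD2pi sinD2pi !add0r addrC.
Qed.

Lemma arg_liftE t : exists2 r : R, 0 < r & cis t - f
  = r%:C * cis (arg_lift f t).
Proof.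
exists (Num.sqrt (D t ^+ 2 + N t ^+ 2)).
  by rewrite sqrtr_gt0 ltr_pwDl ?sqr_ge0// exprn_gt0.
have D0 := D_gt0 t.
set r := Num.sqrt _.
have rE : (Num.sqrt (1 + (N t / D t) ^+ 2))^-1 = D t / r.
  have -> : 1 + (N t / D t) ^+ 2 = (D t ^+ 2 + N t ^+ 2) / D t ^+ 2.
    by field; rewrite gt_eqF.
  rewrite sqrtrM ?addr_ge0 ?sqr_ge0// sqrtrV ?sqr_ge0// sqrtr_sqr gtr0_norm//.
  by rewrite -/r invf_div.
have r0 : r != 0 by rewrite gt_eqF// sqrtr_gt0 ltr_pwDl ?sqr_ge0// exprn_gt0.
rewrite /arg_lift -/f1 -/f2 -/(D t) -/(N t) [cis (_ + _)]/cis cosD sinD.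
have -> : sin (atan (N t / D t)) = N t / r.
  have ca : cos (atan (N t / D t)) != 0
    by rewrite cos_atan rE mulf_neq0 ?invr_neq0// gt_eqF.
  have := atanK (N t / D t); rewrite /tan => /(canRL (mulfVK ca)) ->.
  by rewrite cos_atan rE; field; rewrite r0 gt_eqF.
rewrite cos_atan rE.
have cs : sin t ^+ 2 = 1 - cos t ^+ 2 := sin2cos2 t.
have -> : cis t - f = (cos t - f1) +i* (sin t - f2) by rewrite /f1 /f2;
  case: (f).
apply/eqP; rewrite eq_complex /= !mul0r subr0 addr0; apply/andP; split;
  apply/eqP.
  transitivity (cos t * D t - sin t * N t); last by field.
  by rewrite /D /N; ring: cs.
transitivity (sin t * D t + cos t * N t); last by field.
by rewrite /D /N; ring: cs.
Qed.

Lemma is_derive_arg_lift t :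
  is_derive t 1 (arg_lift f) (D t / (D t ^+ 2 + N t ^+ 2)).
Proof.
have D0 := D_gt0 t.
have dD : is_derive t 1 D (N t).
  by rewrite /D /N; apply: is_derive_eq; rewrite /GRing.scale /=; ring.
have dN : is_derive t 1 N (1 - D t).
  by rewrite /D /N; apply: is_derive_eq; rewrite /GRing.scale /=; ring.
have Dn0 : D t != 0 by rewrite gt_eqF.
have dDV : is_derive t 1 (fun x => (D x)^-1) (- (D t) ^- 2 *: N t)
  by exact: is_deriveV.
have dq : is_derive t 1 (fun x => N x / D x)
    (N t *: (- (D t) ^- 2 *: N t) + (D t)^-1 *: (1 - D t)) by exact: is_deriveM.
have dat : is_derive t 1 (fun x => atan (N x / D x))
    ((1 + (N t / D t) ^+ 2)^-1
     * (N t *: (- (D t) ^- 2 *: N t) + (D t)^-1 *: (1 - D t))).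
  exact: (@is_derive1_comp _ atan (fun x => N x / D x)).
rewrite /arg_lift -/f1 -/f2; apply: is_derive_eq.
have S0 : D t ^+ 2 + N t ^+ 2 != 0
  by rewrite gt_eqF// ltr_pwDl ?sqr_ge0// exprn_gt0.
rewrite /GRing.scale /=; field; rewrite Dn0 S0 /=.
by [].
Qed.

(** With 1 - f / cis t = D + i N, the derivative of the lift is
    D / (D^2 + N^2), and it exceeds 1/2 because D^2 + N^2 = |f|^2 - 1 + 2 D.
    This rate still makes the argument of the Blaschke product, which is
    twice the sum of two such lifts minus t, increase. *)
Lemma arg_lift_incr x y : x < y -> (y - x) / 2 < arg_lift f y - arg_lift f x.
Proof.
move=> xy.
pose h z := arg_lift f z - z / 2.
suff : h x < h y by rewrite /h; lra.
have dh (z : R) : is_derive z 1 h (D z / (D z ^+ 2 + N z ^+ 2) - 2^-1).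
  have d1 := is_derive_arg_lift z.
  by rewrite /h; apply: is_derive_eq; rewrite /GRing.scale /=; ring.
apply: (@gtr0_derive1_incr _ h x y) => //.
- move=> z _; rewrite derive1E derive_val subr_gt0.
  have D0 := D_gt0 z.
  have S0 : 0 < D z ^+ 2 + N z ^+ 2 by rewrite ltr_pwDl ?sqr_ge0// exprn_gt0.
  rewrite ltr_pdivlMr//.
  have -> : D z ^+ 2 + N z ^+ 2
    = (1 - D z) ^+ 2 + N z ^+ 2 - 1 + 2 * D z by ring.
  by rewrite sumsq; move: f_lt1; lra.
- apply: derivable_within_continuous => z _.
  exact: ex_derive.
Qed.

End ArgLift.
End Angles.

(** * Fibres and arguments of the focal quadratic *)

Section Blaschke.
Local Open Scope complex_scope.
Variable R : realType.
Implicit Types (t x y : R).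

Lemma cis_conj t : cis t * (conjc (cis t)) = 1.
Proof. by rewrite -cisN -cisD subrr /cis cos0 sin0. Qed.

(** On the unit circle, the denominator of the Blaschke product is the
    conjugate of its numerator up to the factor z^2. *)
Lemma conj_focal (s p z : R[i]) : z * conjc z = 1 ->
  1 - conjc s * z + conjc p * z ^+ 2 = z ^+ 2 * conjc (z ^+ 2 - s * z + p).
Proof.
move=> zz; rewrite !(rmorphD, rmorphN, rmorphXn, rmorphM) /=.
combine (- (z * conjc z + 1) * residual zz + conjc s * z * residual zz).
Qed.

Lemma normsqM (x y : R[i]) : normsq (x * y) = normsq x * normsq y.
Proof. by case: x y => ? ? [? ?]; rewrite /normsq /=; ring. Qed.

Lemma normsq_cis t : normsq (cis t) = 1.
Proof. exact: cos2Dsin2. Qed.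

Lemma normsq_ge0 (x : R[i]) : 0 <= normsq x.
Proof. by rewrite addr_ge0 ?sqr_ge0. Qed.

Variables f g : R[i].
Hypotheses (f_lt1 : normsq f < 1) (g_lt1 : normsq g < 1).
Let s := f + g.
Let p := f * g.

Lemma focal_prod_lt1 : normsq p < 1.
Proof.
rewrite /p normsqM; have [a0 b0] := (normsq_ge0 f, normsq_ge0 g).
by rewrite (le_lt_trans _ f_lt1)// ler_piMr// ltW.
Qed.

(** This says that the zero (s - p s') / (1 - |p|^2) of the affine function W
    lies in the disc.  One has s - p s' = f (1 - |g|^2) + g (1 - |f|^2), of
    modulus at most (|f| + |g|) (1 - |f g|), and
    |f| + |g| < 1 + |f g|. *)
Lemma pivot_bound : normsq (s - p * conjc s) < (1 - normsq p) ^+ 2.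
Proof.
pose a := Num.sqrt (normsq f); pose b := Num.sqrt (normsq g).
have a2 : normsq f = a ^+ 2 by rewrite sqr_sqrtr ?normsq_ge0.
have b2 : normsq g = b ^+ 2 by rewrite sqr_sqrtr ?normsq_ge0.
have [a0 b0] : 0 <= a /\ 0 <= b by split; exact: sqrtr_ge0.
have a1 : a < 1 by rewrite -sqrtr1 ltr_sqrt.
have b1 : b < 1 by rewrite -sqrtr1 ltr_sqrt.
pose r := complex.Re (f * conjc g).
have rab : r <= a * b.
  have [r0|r0] := leP r 0; first by rewrite (le_trans r0)// mulr_ge0.
  rewrite -ler_sqr ?nnegrE ?mulr_ge0 ?(ltW r0)// exprMn -a2 -b2.
  rewrite -subr_ge0; have -> : normsq f * normsq g - r ^+ 2
    = complex.Im (f * conjc g) ^+ 2.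
    by rewrite /r /normsq; case: (f) (g) => ? ? [? ?] /=; ring.
  exact: sqr_ge0.
have -> : normsq (s - p * conjc s) = normsq f * (1 - normsq g) ^+ 2
    + normsq g * (1 - normsq f) ^+ 2 +
      2 * r * ((1 - normsq f) * (1 - normsq g)).
  by rewrite /s /p /r /normsq; case: (f) (g) => ? ? [? ?] /=; ring.
rewrite /p normsqM a2 b2.
apply: (@le_lt_trans _ _ (((a + b) * (1 - a * b)) ^+ 2)).
  rewrite -subr_ge0.
  have -> : ((a + b) * (1 - a * b)) ^+ 2 - (a ^+ 2 * (1 - b ^+ 2) ^+ 2
      + b ^+ 2 * (1 - a ^+ 2) ^+ 2 + 2 * r * ((1 - a ^+ 2) * (1 - b ^+ 2)))
    = 2 * (a * b - r) * ((1 - a ^+ 2) * (1 - b ^+ 2)) by ring.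
  by rewrite -a2 -b2 !mulr_ge0 ?subr_ge0 ?(ltW f_lt1) ?(ltW g_lt1).
have ab1 : a * b < 1 by rewrite (le_lt_trans _ a1)// ler_piMr// ltW.
have -> : (1 - a ^+ 2 * b ^+ 2) = (1 + a * b) * (1 - a * b) by ring.
have ab1' : 0 < 1 - a * b by rewrite subr_gt0.
have ab0 : 0 <= a * b by rewrite mulr_ge0.
rewrite ltr_sqr ?nnegrE; [|by rewrite mulr_ge0 ?(ltW ab1')// addr_ge0..].
rewrite ltr_pM2r//.
have : 0 < (1 - a) * (1 - b) by rewrite mulr_gt0 ?subr_gt0.
by lra.
Qed.

Definition total_arg t := arg_lift f t + arg_lift g t.

Lemma continuous_total_arg : continuous total_arg.
Proof.
move=> t; apply: differentiable_continuous; apply/derivable1_diffP.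
have d1 := is_derive_arg_lift f_lt1 t; have d2 := is_derive_arg_lift g_lt1 t.
exact: ex_derive.
Qed.

Lemma total_arg_incr x y : x < y -> y - x < total_arg y - total_arg x.
Proof.
by move=> xy; have := arg_lift_incr f_lt1 xy; have := arg_lift_incr g_lt1 xy;
  rewrite /total_arg; lra.
Qed.

Lemma total_arg_turn : total_arg (pi *+ 2) = total_arg 0 + (pi *+ 2) *+ 2.
Proof. by rewrite /total_arg !arg_lift_turn; ring. Qed.

Lemma focal_polar t : exists2 r : R, 0 < r &
  cis t ^+ 2 - s * cis t + p = r%:C * cis (total_arg t).
Proof.
have [r r0 hr] := arg_liftE f_lt1 t; have [q q0 hq] := arg_liftE g_lt1 t.
exists (r * q); rewrite ?mulr_gt0// /total_arg cisD.
transitivity ((cis t - f) * (cis t - g)); first by rewrite /s /p; ring.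
by rewrite hr hq rmorphM; ring.
Qed.

(** The argument of z w(z) / (z^2 w(z)') at z = cis t is 2 arg w - t, an
    increasing function of t that makes three turns. *)
Lemma blaschke_angles l : exists t : 'I_3 -> R,
  [/\ injective t, forall i, 0 <= t i < pi *+ 2 &
   forall i, let z := cis (t i) in
   z * (z ^+ 2 - s * z + p) = cis l * (1 - conjc s * z + conjc p * z ^+ 2)].
Proof.
pose P t := total_arg t + total_arg t - t.
have [||| t [tinj tI tP]] := @turns_crossing _ P 3 l.
- move=> x; apply: cvgB; last exact: cvg_id.
  by apply: cvgD; exact: continuous_total_arg.
- by move=> x y xy; have := total_arg_incr xy; rewrite /P; lra.
- by rewrite /P total_arg_turn; ring.
exists t; split=> // i z; have [r r0] := focal_polar (t i).
have /tP[_ /(_ (ex_intro _ i erefl))] := tI i.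
rewrite -/z => /cis_eq1P + hr; set w := z ^+ 2 - s * z + p in hr *.
have zz : z * conjc z = 1 := cis_conj (t i).
rewrite (conj_focal s p zz) -/w.
have -> : (conjc w) = r%:C * cis (- total_arg (t i)).
  by rewrite hr rmorphM /= oppr0 cisN.
rewrite hr /P => c1.
transitivity (r%:C * (cis (t i + total_arg (t i)))); first by rewrite cisD -/z;
  ring.
rewrite -[t i + _](_ : (total_arg (t i) + total_arg (t i) - t i - l)
   + (l + t i + t i - total_arg (t i)) = _); last by ring.
by rewrite cisD c1 mul1r !cisD -/z; ring.
Qed.

(** The condition says that the argument of w is c modulo a turn, c being 0 or
    pi up to turns; that argument increases by two turns. *)
Lemma contact_angles c : sin c = 0 -> exists t1 t2,
  [/\ t1 <> t2, 0 <= t1 < pi *+ 2, 0 <= t2 < pi *+ 2 &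
  forall t, 0 <= t < pi *+ 2 -> let w := cis t ^+ 2 - s * cis t + p in
    complex.Re w = cos c * Num.sqrt (normsq w) <-> t = t1 \/ t = t2].
Proof.
move=> c0.
have [||| t [tinj tI tP]] := @turns_crossing _ total_arg 2 c.
- exact: continuous_total_arg.
- by move=> x y xy; have := total_arg_incr xy; lra.
- exact: total_arg_turn.
exists (t 0), (t 1); split=> //; first by move/tinj.
move=> x xI /=; have [r r0 ->] := focal_polar x.
have -> : complex.Re (r%:C * cis (total_arg x)) = r * cos (total_arg x).
  by rewrite /= mul0r subr0.
have -> : Num.sqrt (normsq (r%:C * cis (total_arg x))) = r.
  by rewrite normsqM normsq_cis mulr1 /normsq /= expr0n addr0 sqrtr_sqr
    gtr0_norm.
have c2 : cos c ^+ 2 = 1 by rewrite cos2sin2 c0 expr0n subr0.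
have -> : r * cos (total_arg x) = cos c * r <-> cos (total_arg x - c) = 1.
  rewrite cosB c0 mulr0 addr0 [cos c * r]mulrC;
    split=> [/(mulfI (lt0r_neq0 r0)) ->|h].
    by rewrite -expr2.
  by congr (_ * _); rewrite -[LHS]mulr1 -c2 expr2 mulrA h mul1r.
rewrite tP//; split=> [[i ->]|[]->]; [|by exists 0|by exists 1].
by case: i => [[|[]]]// ?; [left|right]; congr t; apply: val_inj.
Qed.

End Blaschke.

(** * Plane paths and star-shaped curves *)

Section PlanePaths.
Variable R : realType.

Lemma is_derive_pair (g1 g2 : R -> R) (t d1 d2 : R) :
  is_derive t (1 : R) g1 d1 -> is_derive t (1 : R) g2 d2 ->
  is_derive t (1 : R) (fun x => (g1 x, g2 x)) (d1, d2).
Proof.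
move=> [h1 e1] [h2 e2].
have D1 : differentiable g1 t by apply/derivable1_diffP.
have D2 : differentiable g2 t by apply/derivable1_diffP.
have D : differentiable (fun x => (g1 x, g2 x)) t by exact: differentiable_pair.
split; first exact: diff_derivable.
by rewrite deriveE// diff_pair// -!deriveE// e1 e2.
Qed.

Lemma is_derive_coord (g : R -> R * R) (t : R) (d : R * R) :
  is_derive t (1 : R) g d ->
  is_derive t (1 : R) (fun x => (g x).1) d.1 /\
  is_derive t (1 : R) (fun x => (g x).2) d.2.
Proof.
move=> [h e].
have D : differentiable g t by apply/derivable1_diffP.
have L1 x : differentiable (@fst R R) x.
  by apply: linear_differentiable => ?; exact: cvg_fst.
have L2 x : differentiable (@snd R R) x.
  by apply: linear_differentiable => ?; exact: cvg_snd.
split; split.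
- by apply: diff_derivable; exact: (@differentiable_comp _ _ _ _ g fst).
- rewrite deriveE; last exact: (@differentiable_comp _ _ _ _ g fst).
  rewrite (@diff_comp _ _ _ _ g fst)//= diff_lin; last by move=> ?;
    exact: cvg_fst.
  by rewrite -deriveE// e.
- by apply: diff_derivable; exact: (@differentiable_comp _ _ _ _ g snd).
- rewrite deriveE; last exact: (@differentiable_comp _ _ _ _ g snd).
  rewrite (@diff_comp _ _ _ _ g snd)//= diff_lin; last by move=> ?;
    exact: cvg_snd.
  by rewrite -deriveE// e.
Qed.

Lemma is_derive_translate (V : normedModType R) (g : R -> V) (t : R) (d : V) :
  is_derive t (1 : R) g d -> is_derive (0 : R) (1 : R) (fun x => g (t + x)) d.
Proof.
move=> [h e].
have E : (fun x : R => x^-1 *: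
  (((fun y => g (t + y)) \o shift 0) (x *: (1 : R)) - g (t + 0)))
       = (fun x : R => x^-1 *: ((g \o shift t) (x *: (1 : R)) - g t)).
  by apply/funext => x /=; rewrite !addr0 [t + _]addrC.
by split; rewrite /derivable /derive E.
Qed.

End PlanePaths.

Section PositiveRoot.
Variable R : realType.
Implicit Types (A B C r : R).

Definition posroot A B C := (- B + Num.sqrt (B ^+ 2 - 4 * A * C)) / (2 * A).

(** As A and C have opposite signs the two roots do as well, so on r >= 0 the
    sign of the quadratic changes exactly at [posroot]. *)
Lemma posroot_factor A B C : 0 < A -> C < 0 ->
  0 < posroot A B C /\ exists2 q, q < 0 & forall r,
    A * r ^+ 2 + B * r + C = A * ((r - posroot A B C) * (r - q)).
Proof.
move=> A0 C0; set d := Num.sqrt (B ^+ 2 - 4 * A * C).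
have AC : 0 < - (4 * A * C) by rewrite oppr_gt0 nmulr_llt0// mulr_gt0.
have d2 : d ^+ 2 = B ^+ 2 - 4 * A * C.
  by rewrite sqr_sqrtr// addr_ge0 ?sqr_ge0// ltW.
have Bd : `|B| < d.
  by rewrite -ltr_sqr ?nnegrE ?sqrtr_ge0// real_normK ?num_real// d2 ltrDl.
move: Bd; rewrite ltr_norml => /andP[Bd1 Bd2].
split; first by rewrite /posroot -/d divr_gt0 ?mulr_gt0//; lra.
exists ((- B - d) / (2 * A)).
  by rewrite ltr_pdivrMr ?mulr_gt0// mul0r; lra.
move=> r; rewrite /posroot -/d.
have An0 : A != 0 by rewrite gt_eqF.
transitivity (A * r ^+ 2 + B * r + (B ^+ 2 - d ^+ 2) / (4 * A)).
  by rewrite d2; field.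
by field.
Qed.

Lemma posroot_gt0 A B C : 0 < A -> C < 0 -> 0 < posroot A B C.
Proof. by move=> A0 C0; case: (posroot_factor B A0 C0). Qed.

Lemma quadratic_le0 A B C r : 0 < A -> C < 0 -> 0 <= r ->
  (A * r ^+ 2 + B * r + C <= 0) = (r <= posroot A B C).
Proof.
move=> A0 C0 r0; have [_ [q q0 ->]] := posroot_factor B A0 C0.
have rq : 0 < r - q by rewrite subr_gt0 (lt_le_trans q0).
by rewrite pmulr_rle0// pmulr_lle0// subr_le0.
Qed.

Lemma quadratic_ge0 A B C r : 0 < A -> C < 0 -> 0 <= r ->
  (0 <= A * r ^+ 2 + B * r + C) = (posroot A B C <= r).
Proof.
move=> A0 C0 r0; have [_ [q q0 ->]] := posroot_factor B A0 C0.
have rq : 0 < r - q by rewrite subr_gt0 (lt_le_trans q0).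
by rewrite pmulr_rge0// pmulr_lge0// subr_ge0.
Qed.

Lemma derivable_posroot (A B : R -> R) C (t : R) : 0 < A t -> C < 0 ->
  derivable A t (1 : R) -> derivable B t (1 : R) ->
  derivable (fun x => posroot (A x) (B x) C) t (1 : R).
Proof.
move=> A0 C0 /derivableP dA /derivableP dB.
have An0 : 2 * A t != 0 by rewrite mulf_neq0 ?gt_eqF.
pose E x := (B x) ^+ 2 - 4 * A x * C.
have dE : is_derive t (1 : R) E (derive E t 1).
  by apply/derivableP/ex_derive; rewrite /E; exact: is_derive_eq.
have E0 : 0 < E t.
  by rewrite /E ltr_wpDl ?sqr_ge0// oppr_gt0 nmulr_llt0// mulr_gt0.
have dS : is_derive t (1 : R) (fun x => Num.sqrt (E x))
  ((2 * Num.sqrt (E t))^-1 * derive E t 1).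
  exact: (@is_derive1_comp _ Num.sqrt E _ _ _ (is_derive1_sqrt E0)).
have dV : is_derive t (1 : R) (fun x => (2 * A x)^-1)
   (- (2 * A t) ^- 2 *: (2 *: 'D_1 A t)).
  by apply: is_deriveV => //; exact: is_deriveZ.
have := is_deriveM (is_deriveD (is_deriveN dB) dS) dV.
by case.
Qed.

End PositiveRoot.

Section Star.
Variable R : realType.
Variables a b X0 Y0 : R.
Hypotheses (a_gt0 : 0 < a) (b_gt0 : 0 < b).
Implicit Types (r c s t : R) (rho : R -> R -> R).

(** Polar coordinates about the point (X0, Y0), after the axes have been scaled
    by a and b. *)
Definition star r c s : R * R := (a * (X0 + r * c), b * (Y0 + r * s)).

Lemma star_polar (q : R * R) :
  exists r c s, [/\ 0 <= r, c ^+ 2 + s ^+ 2 = 1 & q = star r c s].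
Proof.
case: q => x y; pose u := x / a - X0; pose v := y / b - Y0.
have an0 : a != 0 by rewrite gt_eqF.
have bn0 : b != 0 by rewrite gt_eqF.
pose r := Num.sqrt (u ^+ 2 + v ^+ 2).
have r2 : r ^+ 2 = u ^+ 2 + v ^+ 2 by rewrite sqr_sqrtr// addr_ge0 ?sqr_ge0.
have [r0|rn0] := eqVneq r 0.
  exists 0, 1, 0; rewrite expr1n expr0n addr0; split=> //.
  move: r2; rewrite r0 expr0n => /esym/eqP.
  rewrite paddr_eq0 ?sqr_ge0// !sqrf_eq0 => /andP[/eqP u0 /eqP v0].
  rewrite /star !mul0r !addr0 -(subr0_eq u0) -(subr0_eq v0).
  by rewrite ![_ * (_ / _)]mulrC !divfK.
exists r, (u / r), (v / r); split; first exact: sqrtr_ge0.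
  by rewrite !expr_div_n -mulrDl -r2 divff// expf_neq0.
by rewrite /star; congr pair; rewrite /u /v; field; rewrite rn0.
Qed.

Lemma star_inj r r' c c' s s' : 0 < r -> 0 < r' ->
  c ^+ 2 + s ^+ 2 = 1 -> c' ^+ 2 + s' ^+ 2 = 1 ->
  star r c s = star r' c' s' -> [/\ r = r', c = c' & s = s'].
Proof.
move=> r0 r0' cs cs' [/(mulfI (lt0r_neq0 a_gt0))/addrI h1].
move=> /(mulfI (lt0r_neq0 b_gt0))/addrI h2.
have E : r = r'.
  apply/eqP; rewrite -(eqrXn2 (n := 2)) ?ltW//; apply/eqP.
  rewrite -[LHS]mulr1 -[RHS]mulr1 -{1}cs -cs' !mulrDr -!exprMn h1 h2 //.
rewrite -E in h1 h2; split=> //; exact: (mulfI (lt0r_neq0 r0)).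
Qed.

Definition star_curve rho : set (R * R) :=
  [set q | exists c s, c ^+ 2 + s ^+ 2 = 1 /\ q = star (rho c s) c s].

Definition radial rho :=
  (forall c s, c ^+ 2 + s ^+ 2 = 1 -> 0 < rho c s) /\
  (forall t, derivable (fun x => rho (cos x) (sin x)) t (1 : R)).

Definition star_path rho t := star (rho (cos t) (sin t)) (cos t) (sin t).

Definition star_velocity r dr t : R * R :=
  (a * (dr * cos t - r * sin t), b * (dr * sin t + r * cos t)).

Lemma is_derive_star_path rho t dr :
  is_derive t (1 : R) (fun x => rho (cos x) (sin x)) dr ->
  is_derive t (1 : R) (star_path rho)
    (star_velocity (rho (cos t) (sin t)) dr t).
Proof.
move=> d; rewrite /star_path /star /star_velocity; apply: is_derive_pair.
  by apply: is_derive_eq; rewrite /GRing.scale /=; ring.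
by apply: is_derive_eq; rewrite /GRing.scale /=; ring.
Qed.

Lemma star_curve_simple rho : radial rho ->
  simple_closed_curve (star_curve rho).
Proof.
case=> rho0 drho; have T0 := pi2_gt0 R; set T : R := pi *+ 2 in T0.
exists (fun x => star_path rho (T * x)); split.
- apply: continuous_subspaceT => x.
  apply: (@continuous_comp _ _ _ (fun y => T * y) (star_path rho)).
    exact: mulrl_continuous.
  apply: differentiable_continuous; apply/derivable1_diffP.
  have /derivableP d := drho (T * x).
  exact: (ex_derive (is_derive := is_derive_star_path d)).
- by rewrite /star_path mulr0 mulr1 /T -[pi *+ 2]add0r cosD2pi sinD2pi.
- move=> x y; rewrite !inE/= !in_itv/= => /andP[x0 x1] /andP[y0 y1].
  move=> /(star_inj (rho0 _ _ (cos2Dsin2 _)) (rho0 _ _ (cos2Dsin2 _))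
    (cos2Dsin2 _) (cos2Dsin2 _)).
  case=> _ hc hs; apply: (mulfI (lt0r_neq0 T0)).
  by apply: angle_inj hc hs; rewrite mulr_ge0 ?(ltW T0)//= -[ltRHS]mulr1
    ltr_pM2l.
rewrite eqEsubset; split=> [q [c [s [cs ->]]]|q [x _ <-]]; last first.
  by exists (cos (T * x)), (sin (T * x)); split=> //; exact: cos2Dsin2.
have [t [/andP[t0 tT] -> ->]] := angle_exists cs.
exists (t / T); last by rewrite /star_path mulrCA divff ?mulr1// gt_eqF.
by rewrite /= in_itv /= divr_ge0 ?(ltW T0)//= ler_pdivrMr// mul1r ltW.
Qed.

(** The nonnegative difference rho2 - rho1 vanishes at the common point, hence
    so does its derivative there, and the polar parametrizations of the two
    curves have equal velocities. *)
Lemma star_curve_tangent rho1 rho2 (q : R * R) : radial rho1 -> radial rho2 ->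
  (forall c s, c ^+ 2 + s ^+ 2 = 1 -> rho1 c s <= rho2 c s) ->
  star_curve rho1 q -> star_curve rho2 q ->
  tangent_at (star_curve rho1) (star_curve rho2) q.
Proof.
move=> [pos1 d1] [pos2 d2] le12 [c [s [cs qE]]] [c' [s' [cs' qE']]].
have [E Ec Es] : [/\ rho1 c s = rho2 c' s', c = c' & s = s'].
  by apply: star_inj => //; [exact: pos1|exact: pos2|rewrite -qE].
rewrite {}qE' {qE}in E *; subst c' s'.
have [t [_ ct st]] := angle_exists cs; rewrite ct st in E *.
pose r1 x := rho1 (cos x) (sin x); pose r2 x := rho2 (cos x) (sin x).
have /derivableP D1 : derivable r1 t 1 := d1 t.
have /derivableP D2 : derivable r2 t 1 := d2 t.
have Eder : 'D_1 r1 t = 'D_1 r2 t.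
  have [||||_ D0] := @derive1_at_min _ (fun x => r2 x - r1 x) (t - 1) (t + 1) t.
  - by lra.
  - by move=> x _; apply: derivableB; [exact: d2|exact: d1].
  - by rewrite in_itv /=; apply/andP; split; lra.
  - move=> x _; rewrite [X in X <= _](_ : _ = 0) ?subr_ge0 ?le12 ?cos2Dsin2//.
    by rewrite /r1 /r2 E subrr.
  have [_ D3] := is_deriveB D2 D1.
  by apply/esym/eqP; rewrite -subr_eq0 -D3 -D0.
exists (star_velocity (r1 t) ('D_1 r1 t) t).
have r0 : 0 < r1 t := pos1 _ _ (cos2Dsin2 t).
have vel rho : is_derive t (1 : R) (fun x => rho (cos x) (sin x)) ('D_1 r1 t) ->
   rho (cos t) (sin t) = r1 t ->
   velocity_at (star_curve rho) (star_path rho t)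
     (star_velocity (r1 t) ('D_1 r1 t) t).
  move=> d rt; exists (fun x => star_path rho (t + x)); split.
  - by rewrite addr0.
  - by exists 1 => //= x _; exists (cos (t + x)), (sin (t + x)); split=> //;
    exact: cos2Dsin2.
  - have := is_derive_star_path d; rewrite rt.
    exact: is_derive_translate.
split.
- case=> /eqP; rewrite mulf_eq0 gt_eqF//= => /eqP h1 /eqP.
  rewrite mulf_eq0 gt_eqF//= => /eqP h2.
  have : r1 t * (cos t ^+ 2 + sin t ^+ 2) = 0.
    combine (cos t * residual h2 - sin t * residual h1).
  by rewrite cos2Dsin2 mulr1 => /eqP; rewrite gt_eqF.
- by rewrite -E; exact: vel.
- by apply: vel; rewrite ?Eder.
Qed.

End Star.

(** * Tangency of a triangle side to the inner ellipse *)

Section SideTangency.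
Variable R : realType.
Variables (a b : R) (o : R * R) (th al be : R).
Hypotheses (a_gt0 : 0 < a) (b_gt0 : 0 < b) (al_gt0 : 0 < al) (be_gt0 : 0 < be).

(** Centre and conjugate semi-axes of the inner ellipse after the scaling by
    1/a and 1/b that turns the outer one into the unit circle. *)
Definition centre1 := o.1 / a.
Definition centre2 := o.2 / b.
Definition axisU1 := al * cos th / a.
Definition axisU2 := al * sin th / b.
Definition axisV1 := - (be * sin th) / a.
Definition axisV2 := be * cos th / b.
Local Notation O1 := centre1.
Local Notation O2 := centre2.
Local Notation U1 := axisU1.
Local Notation U2 := axisU2.
Local Notation V1 := axisV1.
Local Notation V2 := axisV2.

Let an0 : a != 0. Proof. by rewrite gt_eqF. Qed.
Let bn0 : b != 0. Proof. by rewrite gt_eqF. Qed.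
Let aln0 : al != 0. Proof. by rewrite gt_eqF. Qed.
Let ben0 : be != 0. Proof. by rewrite gt_eqF. Qed.
Let cs2 : sin th ^+ 2 = 1 - cos th ^+ 2. Proof. exact: sin2cos2. Qed.

Lemma axes_independent : U1 * V2 - U2 * V1 != 0.
Proof.
have -> : U1 * V2 - U2 * V1 = al * be / (a * b) * (cos th ^+ 2 + sin th ^+ 2).
  by rewrite /U1 /U2 /V1 /V2; field; rewrite ?an0 ?bn0 ?aln0 ?ben0.
by rewrite cos2Dsin2 mulr1 !mulf_neq0 ?invr_neq0 ?mulf_neq0.
Qed.

Definition ellipse_point c s : R * R :=
  (a * (O1 + U1 * c + V1 * s), b * (O2 + U2 * c + V2 * s)).

Lemma placed_ellipseP q : placed_ellipse o th al be q <->
  exists c s, c ^+ 2 + s ^+ 2 = 1 /\ q = ellipse_point c s.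
Proof.
split=> [h|[c [s [h ->]]]]; last first.
  rewrite /placed_ellipse /ellipse /ellipse_form /frame_coord /= -h.
  have -> : (a * (O1 + U1 * c + V1 * s) - o.1)
    = al * cos th * c - be * sin th * s.
    by rewrite /O1 /U1 /V1; field.
  have -> : (b * (O2 + U2 * c + V2 * s) - o.2)
    = al * sin th * c + be * cos th * s.
    by rewrite /O2 /U2 /V2; field.
  by field: cs2; rewrite ?an0 ?bn0 ?aln0 ?ben0.
exists ((frame_coord o th q).1 / al), ((frame_coord o th q).2 / be); split.
  by rewrite !expr_div_n.
case: q {h} => q1 q2; rewrite /ellipse_point /frame_coord /O1 /O2 /U1 /U2 /V1
  /V2 /=.
congr pair.
  transitivity (o.1 + (q1 - o.1) * (cos th ^+ 2 + sin th ^+ 2)).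
    by rewrite cos2Dsin2; ring.
  by field; rewrite ?an0 ?bn0 ?aln0 ?ben0.
transitivity (o.2 + (q2 - o.2) * (cos th ^+ 2 + sin th ^+ 2)).
  by rewrite cos2Dsin2; ring.
by field; rewrite ?an0 ?bn0 ?aln0 ?ben0.
Qed.

(** A function that is constant on G has zero derivative along every path drawn
    in G; d is that derivative, computed from the velocity v alone. *)
Lemma velocity_constraint (G : set (R * R)) (q v : R * R) (h : R * R -> R)
  (k d : R) :
  (forall p, G p -> h p = k) ->
  (forall g : R -> R * R, g 0 = q -> is_derive (0 : R) (1 : R) g v ->
     is_derive (0 : R) (1 : R) (h \o g) d) ->
  velocity_at G q v -> d = 0.
Proof.
move=> hG hd [g [g0 gG dg]].
have := hd g g0 dg.
have /near_eq_is_derive : \forall x \near (0 : R), (h \o g) x = cst k x.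
  by near=> x; apply: hG; near: x.
by move=> /[apply]; case=> _ <-; rewrite derive_cst.
Unshelve. all: by end_near. Qed.

Section Side.
Variables x1 y1 x2 y2 : R.
Hypotheses (on1 : x1 ^+ 2 + y1 ^+ 2 = 1) (on2 : x2 ^+ 2 + y2 ^+ 2 = 1).
Hypothesis ne12 : (x1, y1) != (x2, y2).
Local Notation side_tangent :=
  (line_tangent O1 O2 U1 U2 V1 V2 (y2 - y1) (x1 - x2) (x1 * y2 - x2 * y1)).
Let nU := (y2 - y1) * U1 + (x1 - x2) * U2.
Let nV := (y2 - y1) * V1 + (x1 - x2) * V2.

(** A common velocity is parallel to the side and tangent to the ellipse.  With
    the point of contact written as [ellipse_point c s], this makes the vector
    (n . U, n . V) proportional to (c, s), where n is normal to the side. *)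
Lemma tangent_side_line q :
  tangent_at (segment (a * x1, b * y1) (a * x2, b * y2))
    (placed_ellipse o th al be) q ->
  side_tangent.
Proof.
move=> [v [v0 vs ve]].
pose h (p : R * R) := (y2 - y1) * (p.1 / a) + (x1 - x2) * (p.2 / b).
have hseg p : segment (a * x1, b * y1) (a * x2, b * y2) p ->
  h p = x1 * y2 - x2 * y1.
  by move=> [t _ <-]; rewrite /h /= /GRing.scale /=; field;
    rewrite ?an0 ?bn0 ?aln0 ?ben0.
have nv : (y2 - y1) * (v.1 / a) + (x1 - x2) * (v.2 / b) = 0.
  apply: (velocity_constraint hseg _ vs) => g _ /is_derive_coord[d1 d2].
  by rewrite /h /comp; apply: is_derive_eq; rewrite /GRing.scale /=; ring.
have qE : h q = x1 * y2 - x2 * y1.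
  by apply: hseg; case: vs => g [<- /nbhs_singleton].
have /placed_ellipseP [c [s [cs qcs]]] : placed_ellipse o th al be q.
  by case: ve => g [<- /nbhs_singleton].
pose xi := (v.1 * cos th + v.2 * sin th) / al.
pose eta := (v.2 * cos th - v.1 * sin th) / be.
have grad : c * xi + s * eta = 0.
  pose k (p : R * R) := ellipse_form al be (frame_coord o th p).
  suff : 2 * (c * xi + s * eta) = 0 by move/eqP;
    rewrite mulf_eq0 pnatr_eq0 => /eqP.
  apply: (velocity_constraint (h := k) (k := 1) _ _ ve) => // g
    g0 /is_derive_coord[d1 d2].
  rewrite /k /ellipse_form /frame_coord /comp /=; apply: is_derive_eq.
  rewrite /GRing.scale /= g0 qcs /= /xi /eta.
  rewrite (_ : a * (O1 + U1 * c + V1 * s)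
    = o.1 + al * cos th * c - be * sin th * s); last first.
    by rewrite /O1 /U1 /V1; field.
  rewrite (_ : b * (O2 + U2 * c + V2 * s)
    = o.2 + al * sin th * c + be * cos th * s); last first.
    by rewrite /O2 /U2 /V2; field.
  by field: cs2; rewrite ?an0 ?bn0 ?aln0 ?ben0.
have [mu [mu1 mu2]] : exists mu, xi = - (s * mu) /\ eta = c * mu.
  exists (c * eta - s * xi); split.
    transitivity (xi * (c ^+ 2 + s ^+ 2)); first by rewrite cs mulr1.
    combine (c * residual grad).
  transitivity (eta * (c ^+ 2 + s ^+ 2)); first by rewrite cs mulr1.
  combine (s * residual grad).
have v1E : v.1 = al * cos th * xi - be * sin th * eta.
  transitivity (v.1 * (cos th ^+ 2 + sin th ^+ 2));
    first by rewrite cos2Dsin2 mulr1.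
  by rewrite /xi /eta; field; rewrite ?an0 ?bn0 ?aln0 ?ben0.
have v2E : v.2 = al * sin th * xi + be * cos th * eta.
  transitivity (v.2 * (cos th ^+ 2 + sin th ^+ 2));
    first by rewrite cos2Dsin2 mulr1.
  by rewrite /xi /eta; field; rewrite ?an0 ?bn0 ?aln0 ?ben0.
have mun0 : mu != 0.
  apply/eqP => mu0; apply: v0; case: (v) v1E v2E => w1 w2 /= -> ->.
  by rewrite mu1 mu2 mu0 !(mulr0, oppr0, subr0, addr0).
have orth : c * nV - s * nU = 0.
  apply: (mulfI mun0); rewrite mulr0 -nv v1E v2E mu1
    mu2 /nU /nV /U1 /U2 /V1 /V2.
  by field; rewrite ?an0 ?bn0 ?aln0 ?ben0.
rewrite /line_tangent -qE qcs /h /= -/nU -/nV.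
have -> : (y2 - y1) * (a * (O1 + U1 * c + V1 * s) / a)
  + (x1 - x2) * (b * (O2 + U2 * c + V2 * s) / b)
  - ((y2 - y1) * O1 + (x1 - x2) * O2) = c * nU + s * nV.
  by rewrite /nU /nV; field; rewrite ?an0 ?bn0 ?aln0 ?ben0.
transitivity ((nU ^+ 2 + nV ^+ 2) * (c ^+ 2 + s ^+ 2));
  last by rewrite cs mulr1.
combine (- (c * nV - s * nU) * residual orth).
Qed.

(** The point of contact of the line lies in the open disc, hence strictly
    between the two ends of the chord, and a path can run through it along the
    segment in both directions. *)
Lemma line_tangent_side :
  (forall c s, c ^+ 2 + s ^+ 2 = 1 ->
     (O1 + U1 * c + V1 * s) ^+ 2 + (O2 + U2 * c + V2 * s) ^+ 2 < 1) ->
  side_tangent ->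
  exists q, tangent_at (segment (a * x1, b * y1) (a * x2, b * y2))
    (placed_ellipse o th al be) q.
Proof.
move=> in_disc; rewrite /line_tangent -/nU -/nV; set e := _ - _ => e2.
have D0 := axes_independent.
have d0 : 0 < (x2 - x1) ^+ 2 + (y2 - y1) ^+ 2.
  rewrite lt_neqAle addr_ge0 ?sqr_ge0// andbT eq_sym paddr_eq0 ?sqr_ge0//.
  rewrite !sqrf_eq0 !subr_eq0; apply: contra ne12 => /andP[/eqP-> /eqP->].
  exact: eqxx.
have e0 : e != 0.
  apply: contraTneq d0 => e0; rewrite e0 expr0n in e2.
  move/esym/eqP: e2; rewrite paddr_eq0 ?sqr_ge0// !sqrf_eq0
    => /andP[/eqP + /eqP +].
  rewrite /nU /nV => u0 v0.
  have -> : y2 - y1 = 0.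
    by apply: (mulfI D0); rewrite mulr0;
      combine (V2 * residual u0 - U2 * residual v0).
  have h : x1 - x2 = 0.
    by apply: (mulfI D0); rewrite mulr0;
      combine (U1 * residual v0 - V1 * residual u0).
  by rewrite -opprB h oppr0 expr0n addr0 ltxx.
pose c := nU / e; pose s := nV / e.
have cs : c ^+ 2 + s ^+ 2 = 1.
  by rewrite !expr_div_n -mulrDl -e2 divff// expf_neq0.
pose q1 := O1 + U1 * c + V1 * s; pose q2 := O2 + U2 * c + V2 * s.
have on_line : (y2 - y1) * q1 + (x1 - x2) * q2 = x1 * y2 - x2 * y1.
  have -> : x1 * y2 - x2 * y1 = (y2 - y1) * O1 + (x1 - x2) * O2 + e
    by rewrite /e; ring.
  have -> : e = (nU ^+ 2 + nV ^+ 2) / e by rewrite -e2 expr2 mulfK.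
  by rewrite /q1 /q2 /c /s /nU /nV; ring.
have orth : (y2 - y1) * (V1 * c - U1 * s) + (x1 - x2) * (V2 * c - U2 * s) = 0.
  by rewrite /c /s /nU /nV; field.
pose d := (x2 - x1) ^+ 2 + (y2 - y1) ^+ 2.
have dn0 : d != 0 by rewrite gt_eqF.
pose tau := ((q1 - x1) * (x2 - x1) + (q2 - y1) * (y2 - y1)) / d.
have q1E : q1 = x1 + tau * (x2 - x1).
  apply: (mulfI dn0); rewrite /tau.
  transitivity (d * x1 + ((q1 - x1) * (x2 - x1) + (q2 - y1) * (y2 - y1)) *
    (x2 - x1)); last by field.
  rewrite /d; combine ((y2 - y1) * residual on_line).
have q2E : q2 = y1 + tau * (y2 - y1).
  apply: (mulfI dn0); rewrite /tau.
  transitivity (d * y1 + ((q1 - x1) * (x2 - x1) + (q2 - y1) * (y2 - y1)) *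
    (y2 - y1)); last by field.
  rewrite /d; combine ((x1 - x2) * residual on_line).
pose mu := ((V1 * c - U1 * s) * (x2 - x1) + (V2 * c - U2 * s) * (y2 - y1)) / d.
have w1E : V1 * c - U1 * s = mu * (x2 - x1).
  apply: (mulfI dn0); rewrite /mu.
  transitivity (((V1 * c - U1 * s) * (x2 - x1) + (V2 * c - U2 * s) * (y2 - y1))
    * (x2 - x1)); last by field.
  rewrite /d; combine ((y2 - y1) * residual orth).
have w2E : V2 * c - U2 * s = mu * (y2 - y1).
  apply: (mulfI dn0); rewrite /mu.
  transitivity (((V1 * c - U1 * s) * (x2 - x1) + (V2 * c - U2 * s) * (y2 - y1))
    * (y2 - y1)); last by field.
  rewrite /d; combine ((x1 - x2) * residual orth).
have mun0 : mu != 0.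
  apply: contraNneq D0 => mu0; rewrite mu0 mul0r in w1E;
    rewrite mu0 mul0r in w2E.
  have c0 : (U1 * V2 - U2 * V1) * c = 0
    by combine (U1 * residual w2E - U2 * residual w1E).
  have s0 : (U1 * V2 - U2 * V1) * s = 0
    by combine (V1 * residual w2E - V2 * residual w1E).
  apply/eqP; transitivity ((U1 * V2 - U2 * V1) * (c ^+ 2 + s ^+ 2));
    first by rewrite cs mulr1.
  combine (c * residual c0 + s * residual s0).
(* A point at parameter tau of a chord has squared norm 1 - tau (1 - tau) d. *)
have tau01 : 0 < tau * (1 - tau).
  have := in_disc _ _ cs; rewrite -/q1 -/q2 q1E q2E.
  have -> : (x1 + tau * (x2 - x1)) ^+ 2 + (y1 + tau * (y2 - y1)) ^+ 2
    = (1 - tau) * (x1 ^+ 2 + y1 ^+ 2) + tau * (x2 ^+ 2 + y2 ^+ 2) -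
      tau * (1 - tau) * d.
    by rewrite /d; ring.
  rewrite on1 on2 !mulr1 subrK gtrBl pmulr_lgt0//.
have [tau0 tau1] : 0 < tau /\ tau < 1 by split; nra.
have [t0 [_ ct st]] := angle_exists cs.
exists (a * q1, b * q2), (a * (x2 - x1), b * (y2 - y1)); split.
- case=> /eqP; rewrite mulf_eq0 (negPf an0) /= => /eqP h1 /eqP.
  rewrite mulf_eq0 (negPf bn0) /= => /eqP h2.
  by move: dn0; rewrite /d h1 h2 expr0n addr0 eqxx.
- exists (fun t => (a * x1 + (tau + t) * (a * (x2 - x1)), b * y1 +
  (tau + t) * (b * (y2 - y1)))).
  split.
  + by rewrite addr0 q1E q2E; congr pair; ring.
  + exists (Num.min tau (1 - tau)) => /=; first by rewrite lt_min tau0 subr_gt0.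
    move=> t /=; rewrite sub0r normrN lt_min !ltr_norml
      => /andP[/andP[h1 h2] /andP[h3 h4]].
    exists (tau + t); first by rewrite /= in_itv /=; apply/andP; split; lra.
    by congr pair; rewrite /= /GRing.scale /=; ring.
  + apply: is_derive_pair; apply: is_derive_eq; rewrite /GRing.scale /=; ring.
- exists (fun t => ellipse_point (cos (t0 + t / mu)) (sin (t0 + t / mu))).
  split.
  + by rewrite mul0r addr0 -ct -st.
  + exists 1 => //= t _; apply/placed_ellipseP.
    by exists (cos (t0 + t / mu)), (sin (t0 + t / mu)); split=> //;
      exact: cos2Dsin2.
  + apply: is_derive_pair.
      apply: is_derive_eq; rewrite /GRing.scale /= mul0r addr0 -ct -st.
      transitivity (a * (V1 * c - U1 * s) / mu); first by field.
      by rewrite w1E; field.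
    apply: is_derive_eq; rewrite /GRing.scale /= mul0r addr0 -ct -st.
    transitivity (b * (V2 * c - U2 * s) / mu); first by field.
    by rewrite w2E; field.
Qed.

End Side.
End SideTangency.

(** * The two envelope curves *)

Section Envelope.
Variable R : realType.
Variables (a b K p1 p2 X0 Y0 : R).
Hypotheses (a_gt0 : 0 < a) (b_gt0 : 0 < b) (K_gt1 : 1 < K).
Hypotheses (p_lt1 : p1 ^+ 2 + p2 ^+ 2 < 1) (P0_lt1 : X0 ^+ 2 + Y0 ^+ 2 < 1).

(** The sum s of the foci expressed by their product p and by the zero
    z0 = X0 + i Y0 of W: the equation is s = z0 + p z0', with z0' the conjugate
    of z0.  Taking z0 rather than s as a parameter keeps the expansions along
    rays from z0 short. *)
Definition pivot_s1 := (1 + p1) * X0 + p2 * Y0.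
Definition pivot_s2 := (1 - p1) * Y0 + p2 * X0.
Local Notation s1 := pivot_s1.
Local Notation s2 := pivot_s2.

(** With z = x/a + i y/b, the function [circle_const] is
    A = K (|z|^2 - 1) + Re w(z), and [circle_cos] and [circle_sin] are the real
    and imaginary parts of W = s' - p' z - z'.  The circles A + Re(l W) = 0, for
    l on the unit circle, are the circumcircles. *)
Definition circle_const (q : R * R) : R :=
  let X := q.1 / a in let Y := q.2 / b in
  K * (X ^+ 2 + Y ^+ 2 - 1) + (X ^+ 2 - Y ^+ 2) - (s1 * X - s2 * Y) + p1.

Definition circle_cos (q : R * R) : R :=
  s1 - (p1 * (q.1 / a) + p2 * (q.2 / b)) - q.1 / a.

Definition circle_sin (q : R * R) : R :=
  - s2 - (p1 * (q.2 / b) - p2 * (q.1 / a)) + q.2 / b.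

Definition circle_amp q := Num.sqrt (circle_cos q ^+ 2 + circle_sin q ^+ 2).

Definition outer_envelope : set (R * R)
  := [set q | circle_const q = circle_amp q].
Definition inner_envelope : set (R * R)
  := [set q | circle_const q = - circle_amp q].

(** Coefficients of A and |W| along the ray from (X0, Y0) in direction
    (c, s). *)
Definition ray_lead (c s : R) := K + c ^+ 2 - s ^+ 2.
Definition ray_lin (c s : R) :=
  2 * K * (X0 * c + Y0 * s) + 2 * (X0 * c - Y0 * s) - (s1 * c - s2 * s).
Definition ray_const := (K - p1) * (X0 ^+ 2 + Y0 ^+ 2 - 1).
Definition ray_amp2 (c s : R) :=
  (c + p1 * c + p2 * s) ^+ 2 + (p1 * s - p2 * c - s) ^+ 2.
Definition ray_amp c s := Num.sqrt (ray_amp2 c s).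

Definition rho_outer c s := posroot (ray_lead c s) (ray_lin c s - ray_amp c s)
  ray_const.
Definition rho_inner c s := posroot (ray_lead c s) (ray_lin c s + ray_amp c s)
  ray_const.
Definition rho_ellipse (c s : R)
  := posroot 1 (2 * (X0 * c + Y0 * s)) (X0 ^+ 2 + Y0 ^+ 2 - 1).

Local Notation star := (star a b X0 Y0).
Let an0 : a != 0. Proof. by rewrite gt_eqF. Qed.
Let bn0 : b != 0. Proof. by rewrite gt_eqF. Qed.

Let starX r c s : (star r c s).1 / a = X0 + r * c.
Proof. by rewrite /= mulrC mulKf. Qed.
Let starY r c s : (star r c s).2 / b = Y0 + r * s.
Proof. by rewrite /= mulrC mulKf. Qed.

Lemma circle_const_star r c s : c ^+ 2 + s ^+ 2 = 1 ->
  circle_const (star r c s) = ray_lead c s * r ^+ 2 + ray_lin c s * r +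
    ray_const.
Proof.
move=> cs; have s2' : s ^+ 2 = 1 - c ^+ 2 by rewrite -cs; ring.
rewrite /circle_const starX starY /ray_lead /ray_lin /ray_const /s1 /s2.
by ring: s2'.
Qed.

Lemma circle_amp_star r c s : 0 <= r ->
  circle_amp (star r c s) = ray_amp c s * r.
Proof.
move=> r0; rewrite /circle_amp /ray_amp.
have -> : circle_cos (star r c s) ^+ 2 + circle_sin (star r c s) ^+ 2
  = ray_amp2 c s * r ^+ 2.
  by rewrite /circle_cos /circle_sin starX starY /ray_amp2 /s1 /s2; ring.
by rewrite sqrtrM ?addr_ge0 ?sqr_ge0// sqrtr_sqr ger0_norm.
Qed.

Lemma ellipse_form_star r c s : c ^+ 2 + s ^+ 2 = 1 ->
  ellipse_form a b (star r c s) - 1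
  = 1 * r ^+ 2 + 2 * (X0 * c + Y0 * s) * r + (X0 ^+ 2 + Y0 ^+ 2 - 1).
Proof.
move=> cs; rewrite /ellipse_form -!expr_div_n starX starY.
combine (r ^+ 2 * residual cs).
Qed.

Lemma ray_lead_gt0 c s : c ^+ 2 + s ^+ 2 = 1 -> 0 < ray_lead c s.
Proof. by rewrite /ray_lead => cs; have := sqr_ge0 c; move: K_gt1; lra. Qed.

Lemma ray_const_lt0 : ray_const < 0.
Proof.
have p11 : p1 < 1.
  apply: contraTlt p_lt1 => h; rewrite -leNgt.
  have := sqr_ge0 p2; have : 1 <= p1 ^+ 2
    by rewrite expr_ge1// (le_trans ler01).
  by lra.
rewrite /ray_const pmulr_rlt0 ?subr_lt0//.
by rewrite subr_gt0 (lt_trans p11).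
Qed.

(** The linear part of W has determinant |p|^2 - 1, up to sign, so it is
    injective. *)
Lemma ray_amp2_gt0 c s : c ^+ 2 + s ^+ 2 = 1 -> 0 < ray_amp2 c s.
Proof.
move=> cs; rewrite lt_neqAle addr_ge0 ?sqr_ge0// andbT eq_sym.
rewrite paddr_eq0 ?sqr_ge0// !sqrf_eq0; apply/negP => /andP[/eqP h1 /eqP h2].
have D0 : 1 - (p1 ^+ 2 + p2 ^+ 2) != 0 by rewrite gt_eqF// subr_gt0.
have c0 : c = 0.
  by apply: (mulfI D0); rewrite mulr0;
    combine ((1 - p1) * residual h1 + p2 * residual h2).
have s0 : s = 0.
  by apply: (mulfI D0); rewrite mulr0;
    combine (- (1 + p1) * residual h2 - p2 * residual h1).
by move/eqP: cs; rewrite c0 s0 expr0n addr0 eq_sym oner_eq0.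
Qed.

Let derivable_ray_amp t : derivable (fun x => ray_amp (cos x) (sin x)) t
  (1 : R).
Proof.
have a0 : 0 < ray_amp2 (cos t) (sin t) by apply: ray_amp2_gt0; exact: cos2Dsin2.
have /derivableP d : derivable (fun x => ray_amp2 (cos x) (sin x)) t 1.
  by rewrite /ray_amp2; apply: ex_derive.
have := @is_derive1_comp _ Num.sqrt (fun x => ray_amp2 (cos x) (sin x)) _ _ _
  (is_derive1_sqrt a0) d.
by case.
Qed.

Let derivable_ray_lead t : derivable (fun x => ray_lead (cos x) (sin x)) t
  (1 : R).
Proof. by rewrite /ray_lead; apply: ex_derive. Qed.

Let derivable_ray_lin t : derivable (fun x => ray_lin (cos x) (sin x)) t
  (1 : R).
Proof. by rewrite /ray_lin; apply: ex_derive. Qed.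

Lemma radial_outer : radial rho_outer.
Proof.
split=> [c s cs|t]; first by rewrite posroot_gt0 ?ray_lead_gt0 ?ray_const_lt0.
have dB := derivableB (@derivable_ray_lin t) (@derivable_ray_amp t).
rewrite /rho_outer; apply: (@derivable_posroot _
  (fun x => ray_lead (cos x) (sin x)) _ _ t _ ray_const_lt0
    (@derivable_ray_lead t) dB).
by rewrite ray_lead_gt0 ?cos2Dsin2.
Qed.

Lemma radial_inner : radial rho_inner.
Proof.
split=> [c s cs|t]; first by rewrite posroot_gt0 ?ray_lead_gt0 ?ray_const_lt0.
have dB := derivableD (@derivable_ray_lin t) (@derivable_ray_amp t).
rewrite /rho_inner; apply: (@derivable_posroot _
  (fun x => ray_lead (cos x) (sin x)) _ _ t _ ray_const_lt0
    (@derivable_ray_lead t) dB).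
by rewrite ray_lead_gt0 ?cos2Dsin2.
Qed.

Lemma radial_ellipse : radial rho_ellipse.
Proof.
split=> [c s cs|t]; first by rewrite posroot_gt0 ?subr_lt0.
have C0 : X0 ^+ 2 + Y0 ^+ 2 - 1 < 0 by rewrite subr_lt0.
have dB : derivable (fun x => 2 * (X0 * cos x + Y0 * sin x)) t (1 : R).
  by apply: ex_derive.
rewrite /rho_ellipse; exact: (@derivable_posroot _ (fun=> 1)
  (fun x => 2 * (X0 * cos x + Y0 * sin x)) _ t ltr01 C0 (derivable_cst _ _ _)
    dB).
Qed.

Lemma outer_le r c s : 0 <= r -> c ^+ 2 + s ^+ 2 = 1 ->
  (circle_const (star r c s) <= circle_amp (star r c s)) = (r <= rho_outer c s).
Proof.
move=> r0 cs; rewrite -subr_le0 circle_const_star// circle_amp_star//.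
rewrite -quadratic_le0 ?ray_lead_gt0 ?ray_const_lt0//; congr (_ <= _); ring.
Qed.

Lemma outer_ge r c s : 0 <= r -> c ^+ 2 + s ^+ 2 = 1 ->
  (circle_amp (star r c s) <= circle_const (star r c s)) = (rho_outer c s <= r).
Proof.
move=> r0 cs; rewrite -subr_ge0 circle_const_star// circle_amp_star//.
rewrite -quadratic_ge0 ?ray_lead_gt0 ?ray_const_lt0//; congr (_ <= _); ring.
Qed.

Lemma inner_le r c s : 0 <= r -> c ^+ 2 + s ^+ 2 = 1 ->
  (circle_const (star r c s) <= - circle_amp (star r c s))
    = (r <= rho_inner c s).
Proof.
move=> r0 cs; rewrite -subr_le0 opprK circle_const_star// circle_amp_star//.
rewrite -quadratic_le0 ?ray_lead_gt0 ?ray_const_lt0//; congr (_ <= _); ring.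
Qed.

Lemma inner_ge r c s : 0 <= r -> c ^+ 2 + s ^+ 2 = 1 ->
  (- circle_amp (star r c s) <= circle_const (star r c s))
    = (rho_inner c s <= r).
Proof.
move=> r0 cs; rewrite -subr_ge0 opprK circle_const_star// circle_amp_star//.
rewrite -quadratic_ge0 ?ray_lead_gt0 ?ray_const_lt0//; congr (_ <= _); ring.
Qed.

Lemma ellipse_le r c s : 0 <= r -> c ^+ 2 + s ^+ 2 = 1 ->
  (ellipse_form a b (star r c s) <= 1) = (r <= rho_ellipse c s).
Proof.
move=> r0 cs; rewrite -subr_le0 ellipse_form_star//.
by rewrite -quadratic_le0 ?subr_lt0.
Qed.

Lemma ellipse_ge r c s : 0 <= r -> c ^+ 2 + s ^+ 2 = 1 ->
  (1 <= ellipse_form a b (star r c s)) = (rho_ellipse c s <= r).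
Proof.
move=> r0 cs; rewrite -subr_ge0 ellipse_form_star//.
by rewrite -quadratic_ge0 ?subr_lt0.
Qed.

Lemma level_star_curve (F G : R * R -> R) rho : radial rho ->
  (forall r c s, 0 <= r -> c ^+ 2 + s ^+ 2 = 1 ->
     (F (star r c s) <= G (star r c s)) = (r <= rho c s)) ->
  (forall r c s, 0 <= r -> c ^+ 2 + s ^+ 2 = 1 ->
     (G (star r c s) <= F (star r c s)) = (rho c s <= r)) ->
  [set q | F q = G q] = star_curve a b X0 Y0 rho.
Proof.
move=> [rho0 _] Fle Fge; rewrite eqEsubset; split=> [q|q [c [s [cs ->]]]] /=.
  have [r [c [s [r0 cs ->]]]] := star_polar X0 Y0 a_gt0 b_gt0 q => FG.
  exists c, s; split=> //; congr (star _ _ _); apply/eqP.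
  by rewrite eq_le -Fle// -Fge// FG lexx.
have r0 := ltW (rho0 _ _ cs).
by apply/eqP; rewrite eq_le Fle// Fge// lexx.
Qed.

Lemma outer_envelopeE : outer_envelope = star_curve a b X0 Y0 rho_outer.
Proof. exact: (level_star_curve radial_outer outer_le outer_ge). Qed.

Lemma inner_envelopeE : inner_envelope = star_curve a b X0 Y0 rho_inner.
Proof. exact: (level_star_curve (G := fun q => - circle_amp q) radial_inner
  inner_le inner_ge). Qed.

Lemma ellipseE : ellipse a b = star_curve a b X0 Y0 rho_ellipse.
Proof. exact: (level_star_curve (G := fun=> 1) radial_ellipse ellipse_le
  ellipse_ge). Qed.

(** On the ellipse |W| = |w| and A = Re w; the second square on the right is
    that of Im w. *)
Lemma circle_amp_ellipse q : ellipse a b q ->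
  circle_cos q ^+ 2 + circle_sin q ^+ 2 = circle_const q ^+ 2 +
   (2 * (q.1 / a) * (q.2 / b) - (s1 * (q.2 / b) + s2 * (q.1 / a)) + p2) ^+ 2.
Proof.
rewrite /ellipse /= /ellipse_form -!expr_div_n => e.
have e' : (q.2 / b) ^+ 2 = 1 - (q.1 / a) ^+ 2 by rewrite -e; ring.
by rewrite /circle_cos /circle_sin /circle_const; ring: e'.
Qed.

Lemma circle_const_ellipse q : ellipse a b q ->
  `|circle_const q| <= circle_amp q.
Proof.
move=> /circle_amp_ellipse E; rewrite /circle_amp E -sqrtr_sqr ler_wsqrtr//.
by rewrite lerDl sqr_ge0.
Qed.

(** At the point where the ray crosses the ellipse, A >= - |W|, so the ray has
    already left the inner curve. *)
Lemma inner_le_ellipse c s : c ^+ 2 + s ^+ 2 = 1 ->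
  rho_inner c s <= rho_ellipse c s.
Proof.
move=> cs; have r0 := ltW (radial_ellipse.1 _ _ cs).
rewrite -inner_ge//; have := circle_const_ellipse
  (q := star (rho_ellipse c s) c s).
rewrite ler_norml => h; apply: (andP (h _)).1.
by rewrite ellipseE; exists c, s.
Qed.

Lemma ellipse_le_outer c s : c ^+ 2 + s ^+ 2 = 1 ->
  rho_ellipse c s <= rho_outer c s.
Proof.
move=> cs; have r0 := ltW (radial_ellipse.1 _ _ cs).
rewrite -outer_le//; have := circle_const_ellipse
  (q := star (rho_ellipse c s) c s).
rewrite ler_norml => h; apply: (andP (h _)).2.
by rewrite ellipseE; exists c, s.
Qed.

Lemma outer_envelope_side : outer_envelope `<=` ellipse a b `|` ellipse_outside
  a b.
Proof.
rewrite outer_envelopeE => q [c [s [cs ->]]].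
have r0 := ltW (radial_outer.1 _ _ cs).
have : 1 <= ellipse_form a b (star (rho_outer c s) c s).
  by rewrite ellipse_ge// ellipse_le_outer.
by rewrite le_eqVlt => /orP[/eqP/esym|]; [left|right].
Qed.

Lemma inner_envelope_side : inner_envelope `<=` ellipse a b `|` ellipse_inside
  a b.
Proof.
rewrite inner_envelopeE => q [c [s [cs ->]]].
have r0 := ltW (radial_inner.1 _ _ cs).
have : ellipse_form a b (star (rho_inner c s) c s) <= 1.
  by rewrite ellipse_le// inner_le_ellipse.
by rewrite le_eqVlt => /orP[/eqP|]; [left|right].
Qed.

Lemma outer_tangent q : outer_envelope q -> ellipse a b q ->
  tangent_at outer_envelope (ellipse a b) q.
Proof.
rewrite outer_envelopeE ellipseE => h1 h2.
have [v [v0 ? ?]] := star_curve_tangent a_gt0 b_gt0 radial_ellipse radial_outer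
  ellipse_le_outer h2 h1.
by exists v.
Qed.

Lemma inner_tangent q : inner_envelope q -> ellipse a b q ->
  tangent_at inner_envelope (ellipse a b) q.
Proof.
rewrite inner_envelopeE ellipseE => h1 h2.
exact: (star_curve_tangent a_gt0 b_gt0 radial_inner radial_ellipse
  inner_le_ellipse h1 h2).
Qed.

End Envelope.

(** * The quartic and the boundary of the region *)

Section QuarticDegree.
Variable R : realType.
Variables c1 c2 c3 c4 c5 d1 d2 d3 e1 e2 e3 : R.
Local Notation Xm := (mpolyX R (mnm1 (ord0 : 'I_2))).
Local Notation Ym := (mpolyX R (mnm1 (ord_max : 'I_2))).

Definition affine_mpoly (k1 k2 k3 : R) : mpoly 2 R :=
  k1 *: Xm + (k2 *: Ym + mpolyC 2 k3).

Definition conic_mpoly : mpoly 2 R :=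
  c1 *: (Xm * Xm) + (c2 *: (Ym * Ym) + affine_mpoly c3 c4 c5).

Definition quartic_mpoly : mpoly 2 R :=
  conic_mpoly * conic_mpoly -
  (affine_mpoly d1 d2 d3 * affine_mpoly d1 d2 d3 +
   affine_mpoly e1 e2 e3 * affine_mpoly e1 e2 e3).

Lemma meval_affine v k1 k2 k3 :
  meval v (affine_mpoly k1 k2 k3) = k1 * v ord0 + (k2 * v ord_max + k3).
Proof. by rewrite /affine_mpoly !mevalD !mevalZ !mevalXU mevalC. Qed.

Lemma meval_conic v : meval v conic_mpoly =
  c1 * (v ord0 * v ord0) + (c2 * (v ord_max * v ord_max)
   + (c3 * v ord0 + (c4 * v ord_max + c5))).
Proof. by rewrite /conic_mpoly 2!mevalD !mevalZ !mevalM !mevalXU meval_affine.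
  Qed.

Lemma msize_affine k1 k2 k3 : (msize (affine_mpoly k1 k2 k3) <= 2)%N.
Proof.
rewrite (leq_trans (msizeD_le _ _))// geq_max (leq_trans (msizeZ_le _ _))
  ?msizeX ?mdeg1//=.
rewrite (leq_trans (msizeD_le _ _))// geq_max (leq_trans (msizeZ_le _ _))
  ?msizeX ?mdeg1//=.
by rewrite msizeC; case: (_ != _).
Qed.

(** The coefficient c1 of the square of the first variable survives, which
    excludes a smaller degree. *)
Lemma msize_conic : c1 != 0 -> msize conic_mpoly = 3%N.
Proof.
move=> c1n0; rewrite /conic_mpoly -!mpolyXD.
have szZ k i : (msize (k *: mpolyX R (mnm_add (mnm1 i) (mnm1 i)) : mpoly 2 R)
  <= 3)%N.
  by rewrite (leq_trans (msizeZ_le _ _))// msizeX mdegD mdeg1.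
apply/eqP; rewrite eqn_leq; apply/andP; split.
  rewrite (leq_trans (msizeD_le _ _))// geq_max szZ.
  rewrite (leq_trans (msizeD_le _ _))// geq_max szZ.
  by rewrite (leq_trans (msize_affine _ _ _)).
pose m := mnm_add (mnm1 (ord0 : 'I_2)) (mnm1 ord0).
have dm : mdeg m = 2%N by rewrite mdegD mdeg1.
suff : m \in msupp (c1 *: mpolyX R m +
  (c2 *: mpolyX R (mnm_add (mnm1 (ord_max : 'I_2)) (mnm1 ord_max))
   + affine_mpoly c3 c4 c5)) by move=> /msize_mdeg_lt; rewrite dm.
rewrite mcoeff_msupp.
rewrite 2!mcoeffD !mcoeffZ !mcoeffX eqxx mulr1.
rewrite (_ : (mnm_add _ _ == m) = false) ?mulr0 ?add0r; last first.
  by apply/negP => /eqP/mnmP/(_ ord0); rewrite !mnmDE !mnm1E.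
rewrite (memN_msupp_eq0 (p := affine_mpoly _ _ _)).
  by rewrite addr0.
by apply: msize_mdeg_ge; rewrite dm msize_affine.
Qed.

(** The square of the conic has degree 4 over a domain, and the two squares of
    affine polynomials are too small to cancel its leading part. *)
Lemma quartic_degree : c1 != 0 -> has_degree quartic_mpoly 4.
Proof.
move=> /msize_conic sz; rewrite /has_degree /quartic_mpoly.
have cn0 : conic_mpoly != 0 by rewrite -msize_poly_eq0 sz.
have sz2 : msize (conic_mpoly * conic_mpoly) = 5%N by rewrite msizeM// sz.
set q := conic_mpoly * _ in sz2 *.
set l := affine_mpoly d1 d2 d3 * _ + _.
have szl : (msize l <= 4)%N.
  have szA k1 k2 k3 : (msize (affine_mpoly k1 k2 k3 * affine_mpoly k1 k2 k3)
    <= 4)%N.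
    have [->|n0] := eqVneq (affine_mpoly k1 k2 k3) 0;
      first by rewrite mul0r msize0.
    rewrite msizeM//; have := msize_affine k1 k2 k3.
    by case: (mmeasure _ _) => [|[|[|]]].
  by rewrite (leq_trans (msizeD_le _ _))// geq_max !szA.
apply/eqP; rewrite eqn_leq; apply/andP; split.
  by rewrite (leq_trans (msizeD_le _ _))// geq_max sz2 msizeN (leq_trans szl).
have := msizeD_le (q - l) l; rewrite subrK sz2 leq_max => /orP[//|].
by move=> h; have := leq_trans h szl.
Qed.

End QuarticDegree.

Section EnvelopeBoundary.
Variable R : realType.
Variables (a b K p1 p2 X0 Y0 : R).
Hypotheses (a_gt0 : 0 < a) (b_gt0 : 0 < b) (K_gt1 : 1 < K).
Hypotheses (p_lt1 : p1 ^+ 2 + p2 ^+ 2 < 1) (P0_lt1 : X0 ^+ 2 + Y0 ^+ 2 < 1).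
Local Notation cc := (circle_const a b K p1 p2 X0 Y0).
Local Notation cw := (circle_cos a b p1 p2 X0 Y0).
Local Notation sw := (circle_sin a b p1 p2 X0 Y0).
Local Notation amp := (circle_amp a b p1 p2 X0 Y0).
Local Notation outer := (outer_envelope a b K p1 p2 X0 Y0).
Local Notation inner := (inner_envelope a b K p1 p2 X0 Y0).

Definition envelope_region : set (R * R) :=
  [set q | cc q ^+ 2 <= cw q ^+ 2 + sw q ^+ 2].

Lemma envelope_regionE q : envelope_region q <-> - amp q <= cc q <= amp q.
Proof.
rewrite -ler_norml /envelope_region /= -(ler_sqr (x := `|_|)) ?nnegrE
  ?sqrtr_ge0//.
by rewrite real_normK ?num_real// sqr_sqrtr// addr_ge0 ?sqr_ge0.
Qed.

Lemma envelope_unionP q :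
  (outer `|` inner) q <-> cc q ^+ 2 - (cw q ^+ 2 + sw q ^+ 2) = 0.
Proof.
have amp2 : amp q ^+ 2 = cw q ^+ 2 + sw q ^+ 2
  by rewrite sqr_sqrtr// addr_ge0 ?sqr_ge0.
rewrite -amp2; split=> [[]/= ->|/eqP]; rewrite ?sqrrN ?subrr// subr_eq0 eqf_sqr.
by move=> /orP[]/eqP; [left|right].
Qed.

(** By Cauchy-Schwarz Re(l W) fills the interval from - |W| to |W| as l runs
    over the unit circle. *)
Lemma envelope_region_swept q : envelope_region q <->
  exists c s, c ^+ 2 + s ^+ 2 = 1 /\ cc q + (c * cw q - s * sw q) = 0.
Proof.
rewrite /envelope_region /=; set A := cc q; set x := cw q; set y := sw q.
split=> [h|[c [s [cs h]]]]; last first.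
  have -> : A = - (c * x - s * y) by apply/eqP; rewrite -addr_eq0 h.
  rewrite sqrrN -subr_ge0 -[X in 0 <= X - _]mulr1 -cs.
  by rewrite (_ : _ - _ = (s * x + c * y) ^+ 2) ?sqr_ge0//; ring.
pose r2 := x ^+ 2 + y ^+ 2.
have [r0|rn0] := eqVneq r2 0.
  exists 1, 0; rewrite expr1n expr0n addr0; split=> //.
  move: h; rewrite -/r2 r0 => h.
  have /eqP : A ^+ 2 = 0 by apply/eqP; rewrite eq_le h sqr_ge0.
  rewrite sqrf_eq0 => /eqP->.
  move/eqP: r0; rewrite paddr_eq0 ?sqr_ge0// !sqrf_eq0 => /andP[/eqP-> /eqP->].
  by rewrite !mulr0 subr0 addr0.
pose k := Num.sqrt (r2 - A ^+ 2).
have k2 : k ^+ 2 = r2 - A ^+ 2 by rewrite sqr_sqrtr// subr_ge0.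
(* The component of l W along the real axis is - A, the other one is k. *)
exists ((- A * x + k * y) / r2), ((A * y + k * x) / r2); split.
  transitivity ((A ^+ 2 + k ^+ 2) * (x ^+ 2 + y ^+ 2) / r2 ^+ 2);
    first by field.
  by rewrite k2 -/r2; field.
transitivity (A * (r2 - (x ^+ 2 + y ^+ 2)) / r2); first by field.
by rewrite subrr mulr0 mul0r.
Qed.

Let X_cvg (q : R * R) : (fun p : R * R => p.1 / a) @ q --> q.1 / a.
Proof. by apply: cvgM; [exact: cvg_fst|exact: cvg_cst]. Qed.
Let Y_cvg (q : R * R) : (fun p : R * R => p.2 / b) @ q --> q.2 / b.
Proof. by apply: cvgM; [exact: cvg_snd|exact: cvg_cst]. Qed.

Let slack q := cw q * cw q + sw q * sw q - cc q * cc q.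

Let slack_continuous : continuous slack.
Proof.
move=> q; have [cX cY] := (@X_cvg q, @Y_cvg q).
have ct (k : R) : (fun _ : R * R => k) @ q --> k by exact: cvg_cst.
have X2 : (fun p : R * R => (p.1 / a) ^+ 2) @ q -->
  (q.1 / a) ^+ 2 by exact: (cvgM cX cX).
have Y2 : (fun p : R * R => (p.2 / b) ^+ 2) @ q -->
  (q.2 / b) ^+ 2 by exact: (cvgM cY cY).
have Ccos : cw @ q --> cw q.
  exact: (cvgB (cvgB (ct _) (cvgD (cvgM (ct _) cX) (cvgM (ct _) cY))) cX).
have Csin : sw @ q --> sw q.
  exact: (cvgD (cvgB (ct _) (cvgB (cvgM (ct _) cY) (cvgM (ct _) cX))) cY).
have Cc : cc @ q --> cc q.
  rewrite /circle_const; cbv zeta.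
  exact: (cvgD (cvgB (cvgD (cvgM (ct _) (cvgB (cvgD X2 Y2) (ct _)))
    (cvgB X2 Y2))
    (cvgB (cvgM (ct _) cX) (cvgM (ct _) cY))) (ct _)).
exact: (cvgB (cvgD (cvgM Ccos Ccos) (cvgM Csin Csin)) (cvgM Cc Cc)).
Qed.

Lemma star_interior_perturb (G : set (R * R)) r c s : 0 < r -> 
  interior G (star a b X0 Y0 r c s) -> exists e, 0 < e < r /\
   G (star a b X0 Y0 (r + e) c s) /\ G (star a b X0 Y0 (r - e) c s).
Proof.
move=> r0 intG.
have : (fun x => star a b X0 Y0 x c s) @ r --> star a b X0 Y0 r c s.
  have ct (k : R) : (fun _ : R => k) @ r --> k by exact: cvg_cst.
  have cx : (fun x : R => a * (X0 + x * c)) @ r --> a * (X0 + r * c).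
    exact: (cvgM (ct _) (cvgD (ct _) (cvgM cvg_id (ct _)))).
  have cy : (fun x : R => b * (Y0 + x * s)) @ r --> b * (Y0 + r * s).
    exact: (cvgM (ct _) (cvgD (ct _) (cvgM cvg_id (ct _)))).
  exact: (cvg_pair cx cy).
move=> /(_ _ intG) [e /= e0 he].
pose d := Num.min e r / 2.
have m0 : 0 < Num.min e r by rewrite lt_min e0.
have [m1 m2] : Num.min e r <= e /\ Num.min e r <= r
  by rewrite !ge_min !lexx orbT.
exists d; rewrite /d; split; first by apply/andP; split; lra.
by split; apply: he => /=; rewrite opprD ?opprK addrA subrr add0r ?normrN
  gtr0_norm; lra.
Qed.

(** The region is closed and the strict inequality defines an open set; moving a
    point of the outer curve outwards, or one of the inner curve inwards, along
    its ray leaves the region. *)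
Lemma boundary_envelope_region : boundary envelope_region = outer `|` inner.
Proof.
have regionE : envelope_region = slack @^-1` [set x | 0 <= x].
  by apply/seteqP; split=> q; rewrite /envelope_region /slack /= -!expr2
    subr_ge0.
have closedR : closed envelope_region.
  rewrite regionE; apply: preimage_closed; last exact: closed_ge.
  by move=> q _; exact: slack_continuous.
rewrite /boundary -(closure_id _).1//; apply/seteqP; split=> q.
  move=> [qR qI]; apply/envelope_unionP.
  move: qR; rewrite regionE /= le_eqVlt => /orP[/eqP h|h].
    by apply/eqP; rewrite -oppr_eq0 opprB; apply/eqP;
      rewrite [RHS]h /slack -!expr2.
  exfalso; apply: qI.
  have : open (slack @^-1` [set x | 0 < x]).
    by apply: open_comp; [move=> ? _; exact: slack_continuous|exact: open_gt].
  rewrite openE => /(_ q h); apply: filterS => x /= /ltW.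
  by rewrite regionE.
move=> qU; split.
  by move/envelope_unionP: qU => /eqP;
    rewrite subr_eq0 /envelope_region /= => /eqP->.
case: qU => [|].
  rewrite outer_envelopeE// => -[c [s [cs ->]]].
  have r0 : 0 < rho_outer K p1 p2 X0 Y0 c s
    := (radial_outer K_gt1 p_lt1 P0_lt1).1 _ _ cs.
  move=> /(star_interior_perturb r0)[e
    [/andP[e0 _] [/envelope_regionE/andP[_]]]].
  by rewrite outer_le ?addr_ge0 ?(ltW e0) ?(ltW r0)// gerDl leNgt e0.
rewrite inner_envelopeE// => -[c [s [cs ->]]].
have r0 : 0 < rho_inner K p1 p2 X0 Y0 c s
  := (radial_inner K_gt1 p_lt1 P0_lt1).1 _ _ cs.
move=> /(star_interior_perturb r0)[e
  [/andP[e0 er] [_ /envelope_regionE/andP[+ _]]]].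
by rewrite inner_ge ?subr_ge0 ?(ltW er)// lerBrDr gerDl leNgt e0.
Qed.

Lemma envelope_quartic : exists Q : mpoly 2 R,
  has_degree Q 4 /\ outer `|` inner = zero_locus Q.
Proof.
have an0 : a != 0 by rewrite gt_eqF.
have bn0 : b != 0 by rewrite gt_eqF.
exists (quartic_mpoly ((K + 1) / a ^+ 2) ((K - 1) / b ^+ 2)
  (- pivot_s1 p1 p2 X0 Y0 / a) (pivot_s2 p1 p2 X0 Y0 / b) (p1 - K)
  (- (1 + p1) / a) (- p2 / b) (pivot_s1 p1 p2 X0 Y0)
  (p2 / a) ((1 - p1) / b) (- pivot_s2 p1 p2 X0 Y0)).
split.
  apply: quartic_degree; rewrite mulf_neq0 ?invr_neq0 ?expf_neq0//.
  by rewrite gt_eqF//; move: K_gt1; lra.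
apply/seteqP; split=> q; rewrite /zero_locus /= => h.
  rewrite -((envelope_unionP q).1 h).
  rewrite /quartic_mpoly mevalB mevalD !mevalM !meval_conic !meval_affine /=.
  by rewrite /circle_const /circle_cos /circle_sin; field; rewrite an0 bn0.
apply/envelope_unionP; rewrite -[RHS]h.
rewrite /quartic_mpoly mevalB mevalD !mevalM !meval_conic !meval_affine /=.
by rewrite /circle_const /circle_cos /circle_sin; field; rewrite an0 bn0.
Qed.

End EnvelopeBoundary.

(** * Poncelet triangles as fibres *)

Section Circumcircle.
Variable R : realType.

Lemma affine_vanish (u v w q : R * R) (D E F : R) : noncollinear u v w ->
  D * u.1 + E * u.2 + F = 0 -> D * v.1 + E * v.2 + F = 0 ->
  D * w.1 + E * w.2 + F = 0 -> D * q.1 + E * q.2 + F = 0.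
Proof.
rewrite /noncollinear => /eqP n0 hu hv hw.
have D0 : D = 0.
  by apply: (mulfI n0); rewrite mulr0;
    combine ((w.2 - u.2) * (residual hv - residual hu)
    - (v.2 - u.2) * (residual hw - residual hu)).
have E0 : E = 0.
  by apply: (mulfI n0); rewrite mulr0;
    combine ((v.1 - u.1) * (residual hw - residual hu)
    - (w.1 - u.1) * (residual hv - residual hu)).
by move: hu; rewrite D0 E0 !mul0r.
Qed.

(** The equations of two circles through the vertices, once normalised to the
    same quadratic part, differ by an affine function vanishing at three
    noncollinear points. *)
Lemma circumcircleE (t : triangle R) (k D E F : R) : k != 0 ->
  let h (q : R * R) := k * (q.1 ^+ 2 + q.2 ^+ 2) + D * q.1 + E * q.2 + F in
  h (vertexA t) = 0 -> h (vertexB t) = 0 -> h (vertexC t) = 0 ->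
  circumcircle t = [set q | h q = 0].
Proof.
move=> k0 h hA hB hC; apply/seteqP; split=> q.
  move=> [m [r [[mA mB mC] mq]]] /=.
  pose c (p : R * R) := (p.1 - m.1) ^+ 2 + (p.2 - m.2) ^+ 2 - r ^+ 2.
  have hc (p : R * R) : h p - k * c p
    = (D + 2 * k * m.1) * p.1 + (E + 2 * k * m.2) * p.2
     + (F - k * (m.1 ^+ 2 + m.2 ^+ 2 - r ^+ 2)) by rewrite /h /c; ring.
  have c0 p : circle m r p -> c p = 0 by rewrite /circle /c /= => ->;
    rewrite subrr.
  have := @affine_vanish (vertexA t) (vertexB t) (vertexC t) q
    (D + 2 * k * m.1) (E + 2 * k * m.2)
    (F - k * (m.1 ^+ 2 + m.2 ^+ 2 - r ^+ 2)) (@triangle_noncollinear _ t).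
  by rewrite -!hc hA hB hC !c0// mulr0 subrr subr0; apply.
move=> /= hq.
pose o := (- D / (2 * k), - E / (2 * k)).
pose A := vertexA t.
pose r := Num.sqrt ((A.1 - o.1) ^+ 2 + (A.2 - o.2) ^+ 2).
have r2 : r ^+ 2 = (A.1 - o.1) ^+ 2 + (A.2 - o.2) ^+ 2
  by rewrite sqr_sqrtr// addr_ge0 ?sqr_ge0.
have onc p : h p = 0 -> circle o r p.
  move=> hp; rewrite /circle /= r2; apply: (mulfI k0).
  apply: (eq_by_residual (c := residual hp - residual hA));
    first by rewrite !residual0 subrr.
  by rewrite /residual /h /A /=; field.
by exists o, r; split; [split|]; apply: onc.
Qed.

End Circumcircle.

Section Porism.
Local Open Scope complex_scope.
Variable R : realType.
Variables (a b : R) (o : R * R) (th al be : R).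
Hypotheses (a_gt0 : 0 < a) (b_gt0 : 0 < b) (al_gt0 : 0 < al) (be_gt0 : 0 < be).
Local Notation O1 := (centre1 a o).
Local Notation O2 := (centre2 b o).
Local Notation U1 := (axisU1 a th al).
Local Notation U2 := (axisU2 b th al).
Local Notation V1 := (axisV1 a th be).
Local Notation V2 := (axisV2 b th be).
Hypothesis in_disc : forall c s, c ^+ 2 + s ^+ 2 = 1 ->
  (O1 + U1 * c + V1 * s) ^+ 2 + (O2 + U2 * c + V2 * s) ^+ 2 < 1.
Local Notation s := (focal_sum O1 O2).
Local Notation p := (focal_prod O1 O2 U1 U2 V1 V2).
Local Notation kap := (focal_const O1 O2 U1 U2 V1 V2)%:C.
Local Notation chord := (tangent_chord s p (conjc s) (conjc p) kap).
Local Notation family := (poncelet_family (ellipse a b)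
  (placed_ellipse o th al be)).

(** The fibre over l of the Blaschke product with zeros 0 and the two foci,
    cleared of denominators. *)
Definition fibre (l z : R[i]) :=
  z * (z ^+ 2 - s * z + p) = l * (1 - conjc s * z + conjc p * z ^+ 2).

Definition vertex_over l (v : R * R) :=
  exists x y, [/\ x ^+ 2 + y ^+ 2 = 1, v = (a * x, b * y) & fibre l (x +i* y)].

Lemma ellipse_scaled v : ellipse a b v ->
  exists x y, x ^+ 2 + y ^+ 2 = 1 /\ v = (a * x, b * y).
Proof.
rewrite /ellipse /ellipse_form /= => h; exists (v.1 / a), (v.2 / b).
split; first by rewrite !expr_div_n.
by rewrite ![_ * (_ / _)]mulrC !divfK ?gt_eqF//; case: (v).
Qed.

Lemma side_chord x1 y1 x2 y2 : x1 ^+ 2 + y1 ^+ 2 = 1 -> x2 ^+ 2 + y2 ^+ 2 = 1 ->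
  (x1, y1) != (x2, y2) ->
  (exists q, tangent_at (segment (a * x1, b * y1) (a * x2, b * y2))
    (placed_ellipse o th al be) q) <-> chord (x1 +i* y1) (x2 +i* y2) = 0.
Proof.
move=> h1 h2 ne; rewrite -line_tangentE//; split=> [[q]|].
  exact: tangent_side_line.
exact: line_tangent_side.
Qed.

(** The two chords at each vertex lead to the other two vertices, so
    [tangent_chord_pair] applies at all three, each time with the product of the
    vertices as value of l. *)
Lemma fibre_of_chords z1 z2 z3 : z1 != z2 -> z2 != z3 -> z1 != z3 ->
  chord z1 z2 = 0 -> chord z2 z3 = 0 -> chord z3 z1 = 0 ->
  [/\ fibre (z1 * z2 * z3) z1, fibre (z1 * z2 * z3) z2 & fibre (z1 * z2 * z3)
    z3].
Proof.
move=> n12 n23 n13 c12 c23 c31.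
have c21 : chord z2 z1 = 0 by rewrite tangent_chordC.
have c32 : chord z3 z2 = 0 by rewrite tangent_chordC.
have c13 : chord z1 z3 = 0 by rewrite tangent_chordC.
rewrite /fibre (tangent_chord_pair n23 c12 c13)
  (tangent_chord_pair n13 c21 c23).
by rewrite (tangent_chord_pair n12 c31 c32); split; ring.
Qed.

Lemma complex_pair_neq (x1 y1 x2 y2 : R) :
  (x1 +i* y1 != x2 +i* y2) = ((x1, y1) != (x2, y2)).
Proof. by rewrite eq_complex. Qed.

(** The closing condition is read off from one side with
    [tangent_chord_vieta]. *)
Lemma family_fibre t : family t ->
  (exists l1 l2, l1 ^+ 2 + l2 ^+ 2 = 1 /\
    [/\ vertex_over (l1 +i* l2) (vertexA t), vertex_over (l1 +i* l2) (vertexB t)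
      & vertex_over (l1 +i* l2) (vertexC t)]) /\
  kap = 1 + p * conjc p - s * conjc s.
Proof.
case: t => A0 B0 C0 nc [[/= eA eB eC] [/= tAB tBC tCA]].
have [x1 [y1 [h1 AE]]] := ellipse_scaled eA.
have [x2 [y2 [h2 BE]]] := ellipse_scaled eB.
have [x3 [y3 [h3 CE]]] := ellipse_scaled eC.
rewrite {}AE {}BE {}CE in nc tAB tBC tCA *.
have n12 : (x1, y1) != (x2, y2).
  by apply/negP => /eqP[E1 E2]; apply: nc; rewrite E1 E2 /=; ring.
have n23 : (x2, y2) != (x3, y3).
  by apply/negP => /eqP[E1 E2]; apply: nc; rewrite E1 E2 /=; ring.
have n13 : (x1, y1) != (x3, y3).
  by apply/negP => /eqP[E1 E2]; apply: nc; rewrite E1 E2 /=; ring.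
have n31 : (x3, y3) != (x1, y1) by rewrite eq_sym.
move/(side_chord h1 h2 n12) in tAB; move/(side_chord h2 h3 n23) in tBC.
move/(side_chord h3 h1 n31) in tCA.
rewrite -complex_pair_neq in n12; rewrite -complex_pair_neq in n23.
rewrite -complex_pair_neq in n13.
have [f1 f2 f3] := fibre_of_chords n12 n23 n13 tAB tBC tCA.
set l := _ * _ * _ in f1 f2 f3.
have lE : l = complex.Re l +i* complex.Im l by case: (l).
split.
  exists (complex.Re l), (complex.Im l); split.
    by rewrite -/(normsq l) /l !normsqM /normsq /= h1 h2 h3 !mulr1.
  rewrite -lE; split; [exists x1, y1|exists x2, y2|exists x3, y3]; by split.
have := tangent_chord_vieta kap (blaschke_vieta n12 n23 n13 f1 f2 f3).
rewrite tAB => /esym/eqP; rewrite !mulf_eq0 subr_eq0.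
have unit_neq0 (x y : R) : x ^+ 2 + y ^+ 2 = 1 -> (x +i* y == 0) = false.
  move=> h; apply/negP => /eqP[x0 y0].
  by move/eqP: h; rewrite x0 y0 expr0n addr0 eq_sym oner_eq0.
by rewrite !unit_neq0//= => /eqP.
Qed.

(** A triangle inscribed in the unit circle has area equal to a quarter of the
    product of its side lengths; the identity is the square of this. *)
Lemma circle_points_noncollinear (x1 y1 x2 y2 x3 y3 : R) :
  x1 ^+ 2 + y1 ^+ 2 = 1 -> x2 ^+ 2 + y2 ^+ 2 = 1 -> x3 ^+ 2 + y3 ^+ 2 = 1 ->
  (x1, y1) != (x2, y2) -> (x2, y2) != (x3, y3) -> (x1, y1) != (x3, y3) ->
  noncollinear (a * x1, b * y1) (a * x2, b * y2) (a * x3, b * y3).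
Proof.
move=> h1 h2 h3 n12 n23 n13; rewrite /noncollinear /=.
have dist (x y x' y' : R) : (x, y) != (x', y') ->
  (x - x') ^+ 2 + (y - y') ^+ 2 != 0.
  apply: contra; rewrite paddr_eq0 ?sqr_ge0// !sqrf_eq0 !subr_eq0.
  by move=> /andP[/eqP-> /eqP->].
set cr := _ - _.
have q1 : y1 ^+ 2 = 1 - x1 ^+ 2 by rewrite -h1; ring.
have q2 : y2 ^+ 2 = 1 - x2 ^+ 2 by rewrite -h2; ring.
have q3 : y3 ^+ 2 = 1 - x3 ^+ 2 by rewrite -h3; ring.
have E : 4 * cr ^+ 2 = (a * b) ^+ 2 * (((x1 - x2) ^+ 2 + (y1 - y2) ^+ 2) *
  ((x2 - x3) ^+ 2 + (y2 - y3) ^+ 2) * ((x1 - x3) ^+ 2 + (y1 - y3) ^+ 2)).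
  by rewrite /cr; ring: q1 q2 q3.
have abn0 : a * b != 0 by rewrite mulf_neq0 ?gt_eqF.
move=> cr0; have := mulf_neq0 (expf_neq0 2 abn0)
  (mulf_neq0 (mulf_neq0 (dist _ _ _ _ n12) (dist _ _ _ _ n23))
    (dist _ _ _ _ n13)).
by rewrite -E cr0 expr0n mulr0 eqxx.
Qed.

Variables f g : R[i].
Hypotheses (f_lt1 : normsq f < 1) (g_lt1 : normsq g < 1).
Hypotheses (fgS : f + g = s) (fgP : f * g = p).

(** The fibre over a unit l has three distinct points, and the closing condition
    makes all three sides tangent. *)
Lemma fibre_family l1 l2 : kap = 1 + p * conjc p - s * conjc s ->
  l1 ^+ 2 + l2 ^+ 2 = 1 ->
  exists t, [/\ family t, vertex_over (l1 +i* l2) (vertexA t),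
    vertex_over (l1 +i* l2) (vertexB t) & vertex_over (l1 +i* l2) (vertexC t)].
Proof.
move=> closure_eq l12; have [l [_ -> ->]] := angle_exists l12.
have [t [tinj tI]] := blaschke_angles f_lt1 g_lt1 l.
rewrite /= fgS fgP => tF.
have ne i j : i != j -> (cos (t i), sin (t i)) != (cos (t j), sin (t j)).
  apply: contra => /eqP[c1 c2]; apply/eqP/tinj; exact: angle_inj.
pose i0 : 'I_3 := 0; pose i1 : 'I_3 := 1; pose i2 : 'I_3 := 2%:R.
have n01 := ne i0 i1 isT; have n12 := ne i1 i2 isT; have n02 := ne i0 i2 isT.
have n20 := ne i2 i0 isT.
have un i : cos (t i) ^+ 2 + sin (t i) ^+ 2 = 1 := cos2Dsin2 _.
pose T := Triangle (circle_points_noncollinear (un i0) (un i1) (un i2) n01 n12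
  n02).
exists T.
have vo i : vertex_over (cos l +i* sin l) (a * cos (t i), b * sin (t i)).
  by exists (cos (t i)), (sin (t i)); split=> //; exact: tF.
split; [|exact: vo..].
have on i : ellipse a b (a * cos (t i), b * sin (t i)).
  rewrite /ellipse /ellipse_form /= !exprMn -(un i); field.
  by rewrite !gt_eqF.
have ch i j k : i != j -> j != k -> i != k -> chord (cis (t i)) (cis (t j)) = 0.
  move=> /ne nij /ne njk /ne nik.
  rewrite -complex_pair_neq in nij; rewrite -complex_pair_neq in njk.
  rewrite -complex_pair_neq in nik.
  rewrite (tangent_chord_vieta _
    (blaschke_vieta nij njk nik (tF i) (tF j) (tF k))).
  by rewrite closure_eq subrr mulr0.
split; first by split; exact: on.
by split; apply/side_chord => //;
  [exact: (ch i0 i1 i2)|exact: (ch i1 i2 i0)|exact: (ch i2 i0 i1)].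
Qed.

End Porism.

(** * The swept region and its contacts with the ellipse *)

Section Bridge.
Local Open Scope complex_scope.
Variable R : realType.

(** The point z0 = (s - p s') / (1 - |p|^2) solves z0 + p z0' = s. *)
Lemma pivot_exists (f g : R[i]) : normsq f < 1 -> normsq g < 1 ->
  exists p1 p2 X0 Y0 : R, [/\ p1 ^+ 2 + p2 ^+ 2 < 1, X0 ^+ 2 + Y0 ^+ 2 < 1,
    f * g = p1 +i* p2 & f + g = pivot_s1 p1 p2 X0 Y0 +i* pivot_s2 p1 p2 X0 Y0].
Proof.
move=> f1 g1; have := focal_prod_lt1 f1 g1; have := pivot_bound f1 g1.
case: (f * g) => p1 p2; case: (f + g) => s1 s2.
set n := 1 - _; rewrite {1}/normsq /= => hz hp.
have n0 : n != 0 by rewrite gt_eqF// subr_gt0.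
move: hz; set u := (X in X ^+ 2 + _ < _); set v := (X in _ + X ^+ 2 < _) => hz.
exists p1, p2, (u / n), (v / n); split=> //.
- by rewrite !expr_div_n -mulrDl ltr_pdivrMr ?mul1r// lt_neqAle eq_sym
  expf_neq0 ?sqr_ge0.
- rewrite /pivot_s1 /pivot_s2; apply/eqP; rewrite eq_complex /=; apply/andP;
  split; apply/eqP.
    transitivity (s1 * n / n); first by rewrite mulfK.
    transitivity (((1 + p1) * u + p2 * v) / n); last by field.
    by congr (_ / _); rewrite /u /v /n /normsq /=; ring.
  transitivity (s2 * n / n); first by rewrite mulfK.
  transitivity (((1 - p1) * v + p2 * u) / n); last by field.
  by congr (_ / _); rewrite /u /v /n /normsq /=; ring.
Qed.

Variables (a b K p1 p2 X0 Y0 : R).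
Hypotheses (a_gt0 : 0 < a) (b_gt0 : 0 < b).
Local Notation s1 := (pivot_s1 p1 p2 X0 Y0).
Local Notation s2 := (pivot_s2 p1 p2 X0 Y0).
Local Notation s := (s1 +i* s2).
Local Notation p := (p1 +i* p2).
Local Notation cc := (circle_const a b K p1 p2 X0 Y0).
Local Notation cw := (circle_cos a b p1 p2 X0 Y0).
Local Notation sw := (circle_sin a b p1 p2 X0 Y0).
Local Notation amp := (circle_amp a b p1 p2 X0 Y0).

Section OnEllipse.
Variables x y : R.
Hypothesis xy1 : x ^+ 2 + y ^+ 2 = 1.
Let z : R[i] := x +i* y.
Let w := z ^+ 2 - s * z + p.
Let X : a * x / a = x. Proof. by rewrite mulrC mulKf ?gt_eqF. Qed.
Let Y : b * y / b = y. Proof. by rewrite mulrC mulKf ?gt_eqF. Qed.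
Let y2 : y ^+ 2 = 1 - x ^+ 2. Proof. by rewrite -xy1; ring. Qed.

Lemma circle_const_focal : cc (a * x, b * y) = complex.Re w.
Proof.
rewrite /circle_const /= X Y xy1 subrr mulr0 /w /z expr2 /=; ring.
Qed.

Lemma circle_amp_focal : amp (a * x, b * y) = Num.sqrt (normsq w).
Proof.
congr (Num.sqrt _); rewrite (circle_amp_ellipse K); last first.
  by rewrite /ellipse /ellipse_form /= -!expr_div_n X Y.
rewrite circle_const_focal /= X Y /normsq; congr (_ + _ ^+ 2).
by rewrite /w /z expr2 /=; ring.
Qed.

(** From z W = - (1 - s' z + p' z^2) and the equation of the fibre one gets
    l W = - w, while A = Re w on the ellipse. *)
Lemma vertex_circle l1 l2 :
  z * w = (l1 +i* l2) * (1 - conjc s * z + conjc p * z ^+ 2) ->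
  cc (a * x, b * y) + (l1 * cw (a * x, b * y) - l2 * sw (a * x, b * y)) = 0.
Proof.
move=> fib.
pose W : R[i] := cw (a * x, b * y) +i* sw (a * x, b * y).
have zW : z * W = - (1 - conjc s * z + conjc p * z ^+ 2).
  rewrite /W /circle_cos /circle_sin /= X Y /z.
  apply/eqP; rewrite eq_complex expr2 /=; apply/andP; split; apply/eqP;
    ring: y2.
have z0 : z != 0.
  apply/negP => /eqP[x0 y0].
  by move/eqP: xy1; rewrite x0 y0 expr0n addr0 eq_sym oner_eq0.
have lW : (l1 +i* l2) * W = - w.
  apply: (mulfI z0); combine ((l1 +i* l2) * residual zW + residual fib).
have -> : l1 * cw (a * x, b * y) - l2 * sw (a * x, b * y)
  = complex.Re ((l1 +i* l2) * W) by [].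
by rewrite lW raddfN circle_const_focal subrr.
Qed.

End OnEllipse.

Lemma contact_points (e : R) : sin e = 0 ->
  forall f g : R[i], normsq f < 1 -> normsq g < 1 -> f + g = s -> f * g = p ->
  exists u v : R * R, u <> v /\
    [set q | cc q = cos e * amp q] `&` ellipse a b = [set u; v].
Proof.
move=> e0 f g f1 g1 fgS fgP; have := contact_angles f1 g1 e0.
rewrite fgS fgP => -[t1 [t2 [ne I1 I2 tP]]].
pose pt t : R * R := (a * cos t, b * sin t).
have pt_on t : ellipse a b (pt t).
  rewrite /ellipse /ellipse_form /= !exprMn -(cos2Dsin2 t); field.
  by rewrite !gt_eqF.
have ptP t : 0 <= t < pi *+ 2 -> cc (pt t) = cos e * amp (pt t) <->
  t = t1 \/ t = t2.
  move=> tI; rewrite -tP// circle_const_focal ?circle_amp_focal ?cos2Dsin2//.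
exists (pt t1), (pt t2); split.
  move=> [/(mulfI (lt0r_neq0 a_gt0)) h1 /(mulfI (lt0r_neq0 b_gt0)) h2].
  exact: ne (angle_inj I1 I2 h1 h2).
apply/seteqP; split=> q /=; last first.
  by move=> [->|->]; split=> //; apply/ptP => //; [left|right].
move=> [h /(ellipse_scaled a_gt0 b_gt0)[x [y [xy qE]]]].
have [t [tI xt yt]] := angle_exists xy.
move: h; rewrite qE xt yt => /(ptP t tI)[->|->]; by [left|right].
Qed.

End Bridge.

Section PonceletRegion.
Local Open Scope complex_scope.
Variable R : realType.
Variables (a b : R) (o : R * R) (th al be : R).
Hypotheses (b_gt0 : 0 < b) (ltba : b < a) (al_gt0 : 0 < al) (be_gt0 : 0 < be).
Hypothesis in_disc : forall c s, c ^+ 2 + s ^+ 2 = 1 ->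
  (centre1 a o + axisU1 a th al * c + axisV1 a th be * s) ^+ 2
  + (centre2 b o + axisU2 b th al * c + axisV2 b th be * s) ^+ 2 < 1.
Variables f g : R[i].
Hypotheses (f_lt1 : normsq f < 1) (g_lt1 : normsq g < 1).
Hypothesis fgS : f + g = focal_sum (centre1 a o) (centre2 b o).
Hypothesis fgP : f * g = focal_prod (centre1 a o) (centre2 b o)
  (axisU1 a th al) (axisU2 b th al) (axisV1 a th be) (axisV2 b th be).
Variables p1 p2 X0 Y0 : R.
Hypothesis pE : f * g = p1 +i* p2.
Hypothesis sE : f + g = pivot_s1 p1 p2 X0 Y0 +i* pivot_s2 p1 p2 X0 Y0.
Let K := (a ^+ 2 + b ^+ 2) / (a ^+ 2 - b ^+ 2).
Local Notation cc := (circle_const a b K p1 p2 X0 Y0).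
Local Notation cw := (circle_cos a b p1 p2 X0 Y0).
Local Notation sw := (circle_sin a b p1 p2 X0 Y0).
Local Notation over := (vertex_over a b o th al be).
Local Notation family :=
  (poncelet_family (ellipse a b) (placed_ellipse o th al be)).

Let a_gt0 : 0 < a. Proof. exact: lt_trans ltba. Qed.
Let ab_gt0 : 0 < a ^+ 2 - b ^+ 2.
Proof. by rewrite subr_gt0 ltr_sqr ?nnegrE ?ltW. Qed.

Lemma circumcircle_over t l1 l2 : over (l1 +i* l2) (vertexA t) ->
  over (l1 +i* l2) (vertexB t) -> over (l1 +i* l2) (vertexC t) ->
  circumcircle t = [set q | cc q + (l1 * cw q - l2 * sw q) = 0].
Proof.
pose s1 := pivot_s1 p1 p2 X0 Y0; pose s2 := pivot_s2 p1 p2 X0 Y0.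
pose k := 2 / (a ^+ 2 - b ^+ 2).
pose D := (- s1 - l1 * (1 + p1) - l2 * p2) / a.
pose E := (s2 - l1 * p2 - l2 * (1 - p1)) / b.
pose F := - K + p1 + l1 * s1 + l2 * s2.
have hE q : cc q + (l1 * cw q - l2 * sw q)
    = k * (q.1 ^+ 2 + q.2 ^+ 2) + D * q.1 + E * q.2 + F.
  rewrite /circle_const /circle_cos /circle_sin /k /D /E /F /s1 /s2 /K; field.
  by rewrite !gt_eqF.
have van v : over (l1 +i* l2) v ->
    k * (v.1 ^+ 2 + v.2 ^+ 2) + D * v.1 + E * v.2 + F = 0.
  move=> [x [y [xy -> fib]]]; rewrite -hE; apply: vertex_circle => //.
  by rewrite -pE -sE fgS fgP.
move=> vA vB vC; under eq_set do rewrite hE.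
apply: circumcircleE; [|exact: van..].
by rewrite mulf_neq0 ?invr_neq0 ?gt_eqF.
Qed.

(** One triangle provides the closing condition, after which the triangles of
    the family are exactly the fibres over the unit circle. *)
Lemma swept_region_envelope : family !=set0 ->
  swept_region family = envelope_region a b K p1 p2 X0 Y0.
Proof.
move=> [t0 t0F].
have closure_eq :=
  (family_fibre a_gt0 b_gt0 al_gt0 be_gt0 in_disc t0F).2.
apply/seteqP; split=> q.
  move=> [t tF tq]; apply/envelope_region_swept.
  have [[l1 [l2 [l12 [vA vB vC]]]] _] :=
    family_fibre a_gt0 b_gt0 al_gt0 be_gt0 in_disc tF.
  by move: tq; rewrite (circumcircle_over vA vB vC) => tq; exists l1, l2.
move=> /envelope_region_swept[l1 [l2 [l12 hq]]].
have [t [tF vA vB vC]] := fibre_family a_gt0 b_gt0 al_gt0 be_gt0 in_disc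
  f_lt1 g_lt1 fgS fgP closure_eq l12.
by exists t => //; rewrite (circumcircle_over vA vB vC).
Qed.

End PonceletRegion.

Theorem proposition2 (R : realType) (a b : R) (o : R * R) (th al be : R)
  (b_gt0 : 0 < b) (ltba : b < a) (al_gt0 : 0 < al) (be_gt0 : 0 < be)
  (nested : placed_ellipse o th al be `<=` ellipse_inside a b)
  (closing :
    poncelet_family (ellipse a b) (placed_ellipse o th al be) !=set0) :
  let region :=
    swept_region (poncelet_family (ellipse a b) (placed_ellipse o th al be)) in
  exists (G1 G2 : set (R * R)) (Q : mpoly 2 R),
    [/\ simple_closed_curve G1 /\ simple_closed_curve G2,
        boundary region = G1 `|` G2,
        has_degree Q 4 /\ G1 `|` G2 = zero_locus Q,
        externally_tangent_at_two_points G1 a b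
      & internally_tangent_at_two_points G2 a b].
Proof.
move=> region.
have a_gt0 : 0 < a := lt_trans b_gt0 ltba.
have in_disc c s : c ^+ 2 + s ^+ 2 = 1 ->
  (centre1 a o + axisU1 a th al * c + axisV1 a th be * s) ^+ 2
  + (centre2 b o + axisU2 b th al * c + axisV2 b th be * s) ^+ 2 < 1.
  move=> cs.
  have : placed_ellipse o th al be (ellipse_point a b o th al be c s).
    by apply/(placed_ellipseP _ _ a_gt0 b_gt0 al_gt0 be_gt0); exists c, s.
  move=> /nested; rewrite /ellipse_inside /ellipse_form /= -!expr_div_n.
  by rewrite ![_ * (_ + _ + _) / _]mulrAC !divff ?gt_eqF// !mul1r.
have D0 := axes_independent th a_gt0 b_gt0 al_gt0 be_gt0.
have [f [g [fgS fgP f1 g1]]] := foci_exist D0 in_disc.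
have [p1 [p2 [X0 [Y0 [p_lt1 P0_lt1 pE sE]]]]] := pivot_exists f1 g1.
pose K := (a ^+ 2 + b ^+ 2) / (a ^+ 2 - b ^+ 2).
have K_gt1 : 1 < K.
  have b2 : 0 < b ^+ 2 by exact: exprn_gt0.
  have ab0 : 0 < a ^+ 2 - b ^+ 2 by rewrite subr_gt0 ltr_sqr ?nnegrE ?ltW.
  by rewrite ltr_pdivlMr// mul1r; lra.
have regE : region = envelope_region a b K p1 p2 X0 Y0.
  exact: (swept_region_envelope b_gt0 ltba al_gt0 be_gt0 in_disc f1 g1 fgS fgP
    pE sE closing).
have [Q [degQ zeroQ]] := envelope_quartic p1 p2 X0 Y0 a_gt0 b_gt0 K_gt1.
pose G1 := outer_envelope a b K p1 p2 X0 Y0.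
pose G2 := inner_envelope a b K p1 p2 X0 Y0.
exists G1, G2, Q.
have G1E : [set q | circle_const a b K p1 p2 X0 Y0 q
                  = cos 0 * circle_amp a b p1 p2 X0 Y0 q] = G1.
  by apply/seteqP; split=> q /=; rewrite cos0 mul1r.
have G2E : [set q | circle_const a b K p1 p2 X0 Y0 q
                  = cos pi * circle_amp a b p1 p2 X0 Y0 q] = G2.
  by apply/seteqP; split=> q /=; rewrite cospi mulN1r.
have [u [v [uv uvE]]] :=
  contact_points K a_gt0 b_gt0 (sin0 R) f1 g1 sE pE.
have [u' [v' [uv' uvE']]] :=
  contact_points K a_gt0 b_gt0 (sinpi R) f1 g1 sE pE.
rewrite G1E in uvE; rewrite G2E in uvE'.
split.
- split.
    rewrite /G1 (outer_envelopeE a_gt0 b_gt0 K_gt1 p_lt1 P0_lt1).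
    exact: (star_curve_simple _ _ a_gt0 b_gt0
      (radial_outer K_gt1 p_lt1 P0_lt1)).
  rewrite /G2 (inner_envelopeE a_gt0 b_gt0 K_gt1 p_lt1 P0_lt1).
  exact: (star_curve_simple _ _ a_gt0 b_gt0 (radial_inner K_gt1 p_lt1 P0_lt1)).
- by rewrite regE boundary_envelope_region.
- by split.
- split; last exact: outer_envelope_side.
  have [uO uE] : (G1 `&` ellipse a b) u by rewrite uvE; left.
  have [vO vE] : (G1 `&` ellipse a b) v by rewrite uvE; right.
  by exists u, v; split=> //; exact: outer_tangent.
- split; last exact: inner_envelope_side.
  have [uI uE] : (G2 `&` ellipse a b) u' by rewrite uvE'; left.
  have [vI vE] : (G2 `&` ellipse a b) v' by rewrite uvE'; right.
  by exists u', v'; split=> //; exact: inner_tangent.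
Qed.
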